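(* Neither Markov's principle nor its negation is derivable in Martin-Löf type theory with a cumulative hierarchy of strict universes. That is, writing $$\mathsf{MP} \;:=\; \prod_{P:\mathbb{N}\to\mathbf{2}}\Bigl(\neg\neg\bigl(\textstyle\sum_{x:\mathbb{N}}P x=0\bigr)\to\textstyle\sum_{x:\mathbb{N}}P x=0\Bigr),$$ there is no closed term of type $\mathsf{MP}$ and no closed term of type $\neg\mathsf{MP}$ in this type theory.
   Context: Martin-Löf type theory is the usual dependent type theory with dependent products $\prod$, dependent sums $\sum$, identity types (written $a=b$), an empty type $\mathbf{0}$, a two-element type $\mathbf{2}$ (with elements $0,1$) and natural numbers $\mathbb{N}$; $\neg A:=A\to\mathbf{0}$. A cumulative hierarchy of strict universes is a sequence of universe types, each closed under the type connectives, with each universe included in the next by a coercion and each having a code in the next, such that the chosen codes for connectives commute strictly (up to judgmental equality) with the coercion maps between universes. ''Derivable'' for a type means that the type has a closed term (global element). Metatheory: ZFC with the Grothendieck universe axiom. *)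

(* Defs.v *)
From Stdlib Require Import List.
Import ListNotations.

(** Martin-Löf type theory with a cumulative hierarchy of strict universes
    [U_0, U_1, ...] à la Tarski, as a deductive system on raw syntax with
    de Bruijn indices. *)

(** Types and terms share one grammar and are told apart by the judgments.
    Every constructor carries its full type annotations (e.g. the application
    [tApp A B f a] of [f : Pi A B]), so that raw terms linearize the algebraic
    presentation of the theory.  Bound variables: [B] and the body [t] of
    [tLam] bind one; the motive [C] of [tAbort], [tIf], [tNatrec] binds one;
    the motive [C] of [tJ] binds two (end point, then path); the step [s] of
    [tNatrec] binds two (number, then inductive hypothesis). *)
Inductive expr : Type :=
| tVar (n : nat)
| tPi (A B : expr)
| tLam (A B t : expr)
| tApp (A B f a : expr)
| tSig (A B : expr)
| tPair (A B a b : expr)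
| tFst (A B p : expr)
| tSnd (A B p : expr)
| tId (A a b : expr)
| tRefl (A a : expr)
| tJ (A a C d b p : expr)
| tEmpty
| tAbort (C t : expr)
| tBool
| tB0
| tB1
| tIf (C c0 c1 t : expr)
| tNat
| tZero
| tSucc (n : expr)
| tNatrec (C z s n : expr)
| tU (i : nat)
| tEl (i : nat) (a : expr)          (* the type coded by [a : U_i] *)
| cPi (i : nat) (a b : expr)        (* codes in [U_i] *)
| cSig (i : nat) (a b : expr)
| cId (i : nat) (a t u : expr)
| cEmpty (i : nat)
| cBool (i : nat)
| cNat (i : nat)
| cU (i : nat)                      (* the code of [U_i] in [U_(i+1)] *)
| tLift (i : nat) (a : expr).       (* the coercion from [U_i] to [U_(i+1)] *)

Definition scons {X : Type} (x : X) (f : nat -> X) (n : nat) : X :=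
  match n with 0 => x | S m => f m end.

Definition up_ren (r : nat -> nat) : nat -> nat := scons 0 (fun n => S (r n)).

Fixpoint ren (r : nat -> nat) (e : expr) : expr :=
  match e with
  | tVar n => tVar (r n)
  | tPi A B => tPi (ren r A) (ren (up_ren r) B)
  | tLam A B t => tLam (ren r A) (ren (up_ren r) B) (ren (up_ren r) t)
  | tApp A B f a => tApp (ren r A) (ren (up_ren r) B) (ren r f) (ren r a)
  | tSig A B => tSig (ren r A) (ren (up_ren r) B)
  | tPair A B a b => tPair (ren r A) (ren (up_ren r) B) (ren r a) (ren r b)
  | tFst A B p => tFst (ren r A) (ren (up_ren r) B) (ren r p)
  | tSnd A B p => tSnd (ren r A) (ren (up_ren r) B) (ren r p)
  | tId A a b => tId (ren r A) (ren r a) (ren r b)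
  | tRefl A a => tRefl (ren r A) (ren r a)
  | tJ A a C d b p =>
      tJ (ren r A) (ren r a) (ren (up_ren (up_ren r)) C)
         (ren r d) (ren r b) (ren r p)
  | tEmpty => tEmpty
  | tAbort C t => tAbort (ren (up_ren r) C) (ren r t)
  | tBool => tBool
  | tB0 => tB0
  | tB1 => tB1
  | tIf C c0 c1 t => tIf (ren (up_ren r) C) (ren r c0) (ren r c1) (ren r t)
  | tNat => tNat
  | tZero => tZero
  | tSucc n => tSucc (ren r n)
  | tNatrec C z s n =>
      tNatrec (ren (up_ren r) C) (ren r z) (ren (up_ren (up_ren r)) s) (ren r n)
  | tU i => tU i
  | tEl i a => tEl i (ren r a)
  | cPi i a b => cPi i (ren r a) (ren (up_ren r) b)
  | cSig i a b => cSig i (ren r a) (ren (up_ren r) b)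
  | cId i a t u => cId i (ren r a) (ren r t) (ren r u)
  | cEmpty i => cEmpty i
  | cBool i => cBool i
  | cNat i => cNat i
  | cU i => cU i
  | tLift i a => tLift i (ren r a)
  end.

Definition wk (e : expr) : expr := ren S e.

Definition up (s : nat -> expr) : nat -> expr :=
  scons (tVar 0) (fun n => wk (s n)).

Fixpoint subst (s : nat -> expr) (e : expr) : expr :=
  match e with
  | tVar n => s n
  | tPi A B => tPi (subst s A) (subst (up s) B)
  | tLam A B t => tLam (subst s A) (subst (up s) B) (subst (up s) t)
  | tApp A B f a => tApp (subst s A) (subst (up s) B) (subst s f) (subst s a)
  | tSig A B => tSig (subst s A) (subst (up s) B)
  | tPair A B a b => tPair (subst s A) (subst (up s) B) (subst s a) (subst s b)
  | tFst A B p => tFst (subst s A) (subst (up s) B) (subst s p)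
  | tSnd A B p => tSnd (subst s A) (subst (up s) B) (subst s p)
  | tId A a b => tId (subst s A) (subst s a) (subst s b)
  | tRefl A a => tRefl (subst s A) (subst s a)
  | tJ A a C d b p =>
      tJ (subst s A) (subst s a) (subst (up (up s)) C)
         (subst s d) (subst s b) (subst s p)
  | tEmpty => tEmpty
  | tAbort C t => tAbort (subst (up s) C) (subst s t)
  | tBool => tBool
  | tB0 => tB0
  | tB1 => tB1
  | tIf C c0 c1 t => tIf (subst (up s) C) (subst s c0) (subst s c1) (subst s t)
  | tNat => tNat
  | tZero => tZero
  | tSucc n => tSucc (subst s n)
  | tNatrec C z s' n =>
      tNatrec (subst (up s) C) (subst s z) (subst (up (up s)) s') (subst s n)
  | tU i => tU i
  | tEl i a => tEl i (subst s a)
  | cPi i a b => cPi i (subst s a) (subst (up s) b)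
  | cSig i a b => cSig i (subst s a) (subst (up s) b)
  | cId i a t u => cId i (subst s a) (subst s t) (subst s u)
  | cEmpty i => cEmpty i
  | cBool i => cBool i
  | cNat i => cNat i
  | cU i => cU i
  | tLift i a => tLift i (subst s a)
  end.

Definition subst1 (a : expr) : expr -> expr := subst (scons a tVar).

(** [subst2 b p C] replaces variable 0 of [C] by [p] and variable 1 by [b]. *)
Definition subst2 (b p : expr) : expr -> expr :=
  subst (scons p (scons b tVar)).

(** [C[succ n]] in a context extended by [n : Nat] and one further variable. *)
Definition substS : expr -> expr :=
  subst (scons (tSucc (tVar 1)) (fun n => tVar (S (S n)))).

(** Innermost declaration first. *)
Definition ctx : Type := list expr.

Inductive lookup : ctx -> nat -> expr -> Prop :=
| lookup_here (G : ctx) (A : expr) : lookup (A :: G) 0 (wk A)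
| lookup_there (G : ctx) (A B : expr) (n : nat) :
    lookup G n A -> lookup (B :: G) (S n) (wk A).

(** [G, y : A, p : a = y], the context of the motive of path induction. *)
Definition ctxJ (G : ctx) (A a : expr) : ctx :=
  tId (wk A) (wk a) (tVar 0) :: A :: G.

(** The five judgments: [G] is a context; [A] is a type; [A] and [A'] are
    judgmentally equal types; [t] is a term of type [A]; [t] and [t'] are
    judgmentally equal terms of type [A].  Identity types are intensional:
    there is no equality reflection rule. *)
Inductive wf_ctx : ctx -> Prop :=
| wf_nil : wf_ctx []
| wf_cons (G : ctx) (A : expr) :
    wf_ctx G -> is_type G A -> wf_ctx (A :: G)

with is_type : ctx -> expr -> Prop :=
| ty_Pi G A B : is_type G A -> is_type (A :: G) B -> is_type G (tPi A B)
| ty_Sig G A B : is_type G A -> is_type (A :: G) B -> is_type G (tSig A B)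
| ty_Id G A a b :
    is_type G A -> has_type G a A -> has_type G b A -> is_type G (tId A a b)
| ty_Empty G : wf_ctx G -> is_type G tEmpty
| ty_Bool G : wf_ctx G -> is_type G tBool
| ty_Nat G : wf_ctx G -> is_type G tNat
| ty_U G i : wf_ctx G -> is_type G (tU i)
| ty_El G i a : has_type G a (tU i) -> is_type G (tEl i a)

with eq_type : ctx -> expr -> expr -> Prop :=
| eqty_refl G A : is_type G A -> eq_type G A A
| eqty_sym G A A' : eq_type G A A' -> eq_type G A' A
| eqty_trans G A A' A'' :
    eq_type G A A' -> eq_type G A' A'' -> eq_type G A A''
| eqty_Pi G A A' B B' :
    is_type G A -> eq_type G A A' -> eq_type (A :: G) B B' ->
    eq_type G (tPi A B) (tPi A' B')
| eqty_Sig G A A' B B' :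
    is_type G A -> eq_type G A A' -> eq_type (A :: G) B B' ->
    eq_type G (tSig A B) (tSig A' B')
| eqty_Id G A A' a a' b b' :
    eq_type G A A' -> eq_term G a a' A -> eq_term G b b' A ->
    eq_type G (tId A a b) (tId A' a' b')
| eqty_El G i a a' :
    eq_term G a a' (tU i) -> eq_type G (tEl i a) (tEl i a')
(* decoding *)
| eqty_El_Pi G i a b :
    has_type G a (tU i) -> has_type (tEl i a :: G) b (tU i) ->
    eq_type G (tEl i (cPi i a b)) (tPi (tEl i a) (tEl i b))
| eqty_El_Sig G i a b :
    has_type G a (tU i) -> has_type (tEl i a :: G) b (tU i) ->
    eq_type G (tEl i (cSig i a b)) (tSig (tEl i a) (tEl i b))
| eqty_El_Id G i a t u :
    has_type G a (tU i) -> has_type G t (tEl i a) -> has_type G u (tEl i a) ->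
    eq_type G (tEl i (cId i a t u)) (tId (tEl i a) t u)
| eqty_El_Empty G i : wf_ctx G -> eq_type G (tEl i (cEmpty i)) tEmpty
| eqty_El_Bool G i : wf_ctx G -> eq_type G (tEl i (cBool i)) tBool
| eqty_El_Nat G i : wf_ctx G -> eq_type G (tEl i (cNat i)) tNat
| eqty_El_U G i : wf_ctx G -> eq_type G (tEl (S i) (cU i)) (tU i)
| eqty_El_Lift G i a :
    has_type G a (tU i) -> eq_type G (tEl (S i) (tLift i a)) (tEl i a)

with has_type : ctx -> expr -> expr -> Prop :=
| tm_Var G n A : wf_ctx G -> lookup G n A -> has_type G (tVar n) A
| tm_Conv G t A A' : has_type G t A -> eq_type G A A' -> has_type G t A'
| tm_Lam G A B t :
    is_type G A -> is_type (A :: G) B -> has_type (A :: G) t B ->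
    has_type G (tLam A B t) (tPi A B)
| tm_App G A B f a :
    is_type G A -> is_type (A :: G) B ->
    has_type G f (tPi A B) -> has_type G a A ->
    has_type G (tApp A B f a) (subst1 a B)
| tm_Pair G A B a b :
    is_type G A -> is_type (A :: G) B ->
    has_type G a A -> has_type G b (subst1 a B) ->
    has_type G (tPair A B a b) (tSig A B)
| tm_Fst G A B p :
    is_type G A -> is_type (A :: G) B -> has_type G p (tSig A B) ->
    has_type G (tFst A B p) A
| tm_Snd G A B p :
    is_type G A -> is_type (A :: G) B -> has_type G p (tSig A B) ->
    has_type G (tSnd A B p) (subst1 (tFst A B p) B)
| tm_Refl G A a :
    is_type G A -> has_type G a A -> has_type G (tRefl A a) (tId A a a)
| tm_J G A a C d b p :
    is_type G A -> has_type G a A -> is_type (ctxJ G A a) C ->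
    has_type G d (subst2 a (tRefl A a) C) ->
    has_type G b A -> has_type G p (tId A a b) ->
    has_type G (tJ A a C d b p) (subst2 b p C)
| tm_Abort G C t :
    is_type (tEmpty :: G) C -> has_type G t tEmpty ->
    has_type G (tAbort C t) (subst1 t C)
| tm_B0 G : wf_ctx G -> has_type G tB0 tBool
| tm_B1 G : wf_ctx G -> has_type G tB1 tBool
| tm_If G C c0 c1 t :
    is_type (tBool :: G) C ->
    has_type G c0 (subst1 tB0 C) -> has_type G c1 (subst1 tB1 C) ->
    has_type G t tBool ->
    has_type G (tIf C c0 c1 t) (subst1 t C)
| tm_Zero G : wf_ctx G -> has_type G tZero tNat
| tm_Succ G n : has_type G n tNat -> has_type G (tSucc n) tNat
| tm_Natrec G C z s n :
    is_type (tNat :: G) C ->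
    has_type G z (subst1 tZero C) ->
    has_type (C :: tNat :: G) s (substS C) ->
    has_type G n tNat ->
    has_type G (tNatrec C z s n) (subst1 n C)
| tm_cPi G i a b :
    has_type G a (tU i) -> has_type (tEl i a :: G) b (tU i) ->
    has_type G (cPi i a b) (tU i)
| tm_cSig G i a b :
    has_type G a (tU i) -> has_type (tEl i a :: G) b (tU i) ->
    has_type G (cSig i a b) (tU i)
| tm_cId G i a t u :
    has_type G a (tU i) -> has_type G t (tEl i a) -> has_type G u (tEl i a) ->
    has_type G (cId i a t u) (tU i)
| tm_cEmpty G i : wf_ctx G -> has_type G (cEmpty i) (tU i)
| tm_cBool G i : wf_ctx G -> has_type G (cBool i) (tU i)
| tm_cNat G i : wf_ctx G -> has_type G (cNat i) (tU i)
| tm_cU G i : wf_ctx G -> has_type G (cU i) (tU (S i))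
| tm_Lift G i a : has_type G a (tU i) -> has_type G (tLift i a) (tU (S i))

with eq_term : ctx -> expr -> expr -> expr -> Prop :=
| eqtm_refl G t A : has_type G t A -> eq_term G t t A
| eqtm_sym G t t' A : eq_term G t t' A -> eq_term G t' t A
| eqtm_trans G t t' t'' A :
    eq_term G t t' A -> eq_term G t' t'' A -> eq_term G t t'' A
| eqtm_Conv G t t' A A' :
    eq_term G t t' A -> eq_type G A A' -> eq_term G t t' A'
(* congruence *)
| eqtm_Lam G A A' B B' t t' :
    is_type G A -> eq_type G A A' -> eq_type (A :: G) B B' ->
    eq_term (A :: G) t t' B ->
    eq_term G (tLam A B t) (tLam A' B' t') (tPi A B)
| eqtm_App G A A' B B' f f' a a' :
    is_type G A -> eq_type G A A' -> eq_type (A :: G) B B' ->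
    eq_term G f f' (tPi A B) -> eq_term G a a' A ->
    eq_term G (tApp A B f a) (tApp A' B' f' a') (subst1 a B)
| eqtm_Pair G A A' B B' a a' b b' :
    is_type G A -> eq_type G A A' -> eq_type (A :: G) B B' ->
    eq_term G a a' A -> eq_term G b b' (subst1 a B) ->
    eq_term G (tPair A B a b) (tPair A' B' a' b') (tSig A B)
| eqtm_Fst G A A' B B' p p' :
    is_type G A -> eq_type G A A' -> eq_type (A :: G) B B' ->
    eq_term G p p' (tSig A B) ->
    eq_term G (tFst A B p) (tFst A' B' p') A
| eqtm_Snd G A A' B B' p p' :
    is_type G A -> eq_type G A A' -> eq_type (A :: G) B B' ->
    eq_term G p p' (tSig A B) ->
    eq_term G (tSnd A B p) (tSnd A' B' p') (subst1 (tFst A B p) B)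
| eqtm_Refl G A A' a a' :
    eq_type G A A' -> eq_term G a a' A ->
    eq_term G (tRefl A a) (tRefl A' a') (tId A a a)
| eqtm_J G A A' a a' C C' d d' b b' p p' :
    is_type G A -> has_type G a A ->
    eq_type G A A' -> eq_term G a a' A -> eq_type (ctxJ G A a) C C' ->
    eq_term G d d' (subst2 a (tRefl A a) C) ->
    eq_term G b b' A -> eq_term G p p' (tId A a b) ->
    eq_term G (tJ A a C d b p) (tJ A' a' C' d' b' p') (subst2 b p C)
| eqtm_Abort G C C' t t' :
    eq_type (tEmpty :: G) C C' -> eq_term G t t' tEmpty ->
    eq_term G (tAbort C t) (tAbort C' t') (subst1 t C)
| eqtm_If G C C' c0 c0' c1 c1' t t' :
    eq_type (tBool :: G) C C' ->
    eq_term G c0 c0' (subst1 tB0 C) -> eq_term G c1 c1' (subst1 tB1 C) ->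
    eq_term G t t' tBool ->
    eq_term G (tIf C c0 c1 t) (tIf C' c0' c1' t') (subst1 t C)
| eqtm_Succ G n n' : eq_term G n n' tNat -> eq_term G (tSucc n) (tSucc n') tNat
| eqtm_Natrec G C C' z z' s s' n n' :
    is_type (tNat :: G) C -> eq_type (tNat :: G) C C' ->
    eq_term G z z' (subst1 tZero C) ->
    eq_term (C :: tNat :: G) s s' (substS C) ->
    eq_term G n n' tNat ->
    eq_term G (tNatrec C z s n) (tNatrec C' z' s' n') (subst1 n C)
| eqtm_cPi G i a a' b b' :
    has_type G a (tU i) ->
    eq_term G a a' (tU i) -> eq_term (tEl i a :: G) b b' (tU i) ->
    eq_term G (cPi i a b) (cPi i a' b') (tU i)
| eqtm_cSig G i a a' b b' :
    has_type G a (tU i) ->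
    eq_term G a a' (tU i) -> eq_term (tEl i a :: G) b b' (tU i) ->
    eq_term G (cSig i a b) (cSig i a' b') (tU i)
| eqtm_cId G i a a' t t' u u' :
    eq_term G a a' (tU i) ->
    eq_term G t t' (tEl i a) -> eq_term G u u' (tEl i a) ->
    eq_term G (cId i a t u) (cId i a' t' u') (tU i)
| eqtm_Lift G i a a' :
    eq_term G a a' (tU i) -> eq_term G (tLift i a) (tLift i a') (tU (S i))
(* computation and uniqueness *)
| eqtm_Pi_beta G A B t a :
    is_type G A -> is_type (A :: G) B ->
    has_type (A :: G) t B -> has_type G a A ->
    eq_term G (tApp A B (tLam A B t) a) (subst1 a t) (subst1 a B)
| eqtm_Pi_eta G A B f :
    is_type G A -> is_type (A :: G) B -> has_type G f (tPi A B) ->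
    eq_term G f
      (tLam A B (tApp (wk A) (ren (up_ren S) B) (wk f) (tVar 0)))
      (tPi A B)
| eqtm_Fst_beta G A B a b :
    is_type G A -> is_type (A :: G) B ->
    has_type G a A -> has_type G b (subst1 a B) ->
    eq_term G (tFst A B (tPair A B a b)) a A
| eqtm_Snd_beta G A B a b :
    is_type G A -> is_type (A :: G) B ->
    has_type G a A -> has_type G b (subst1 a B) ->
    eq_term G (tSnd A B (tPair A B a b)) b (subst1 a B)
| eqtm_Sig_eta G A B p :
    is_type G A -> is_type (A :: G) B -> has_type G p (tSig A B) ->
    eq_term G p (tPair A B (tFst A B p) (tSnd A B p)) (tSig A B)
| eqtm_J_beta G A a C d :
    is_type G A -> has_type G a A -> is_type (ctxJ G A a) C ->
    has_type G d (subst2 a (tRefl A a) C) ->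
    eq_term G (tJ A a C d a (tRefl A a)) d (subst2 a (tRefl A a) C)
| eqtm_If_B0 G C c0 c1 :
    is_type (tBool :: G) C ->
    has_type G c0 (subst1 tB0 C) -> has_type G c1 (subst1 tB1 C) ->
    eq_term G (tIf C c0 c1 tB0) c0 (subst1 tB0 C)
| eqtm_If_B1 G C c0 c1 :
    is_type (tBool :: G) C ->
    has_type G c0 (subst1 tB0 C) -> has_type G c1 (subst1 tB1 C) ->
    eq_term G (tIf C c0 c1 tB1) c1 (subst1 tB1 C)
| eqtm_Natrec_Zero G C z s :
    is_type (tNat :: G) C ->
    has_type G z (subst1 tZero C) ->
    has_type (C :: tNat :: G) s (substS C) ->
    eq_term G (tNatrec C z s tZero) z (subst1 tZero C)
| eqtm_Natrec_Succ G C z s n :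
    is_type (tNat :: G) C ->
    has_type G z (subst1 tZero C) ->
    has_type (C :: tNat :: G) s (substS C) ->
    has_type G n tNat ->
    eq_term G (tNatrec C z s (tSucc n)) (subst2 n (tNatrec C z s n) s)
      (subst1 (tSucc n) C)
(* codes commute strictly with the coercions between universes *)
| eqtm_Lift_Pi G i a b :
    has_type G a (tU i) -> has_type (tEl i a :: G) b (tU i) ->
    eq_term G (tLift i (cPi i a b)) (cPi (S i) (tLift i a) (tLift i b))
      (tU (S i))
| eqtm_Lift_Sig G i a b :
    has_type G a (tU i) -> has_type (tEl i a :: G) b (tU i) ->
    eq_term G (tLift i (cSig i a b)) (cSig (S i) (tLift i a) (tLift i b))
      (tU (S i))
| eqtm_Lift_Id G i a t u :
    has_type G a (tU i) -> has_type G t (tEl i a) -> has_type G u (tEl i a) ->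
    eq_term G (tLift i (cId i a t u)) (cId (S i) (tLift i a) t u) (tU (S i))
| eqtm_Lift_Empty G i :
    wf_ctx G -> eq_term G (tLift i (cEmpty i)) (cEmpty (S i)) (tU (S i))
| eqtm_Lift_Bool G i :
    wf_ctx G -> eq_term G (tLift i (cBool i)) (cBool (S i)) (tU (S i))
| eqtm_Lift_Nat G i :
    wf_ctx G -> eq_term G (tLift i (cNat i)) (cNat (S i)) (tU (S i)).

Definition derivable (A : expr) : Prop := exists t : expr, has_type [] t A.

Definition tArr (A B : expr) : expr := tPi A (wk B).

Definition tNot (A : expr) : expr := tArr A tEmpty.

(** [Sigma (x : Nat), P x = 0], for a term [P : Nat -> Bool]. *)
Definition has_zero (P : expr) : expr :=
  tSig tNat (tId tBool (tApp tNat tBool (wk P) (tVar 0)) tB0).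

Definition MP : expr :=
  tPi (tArr tNat tBool)
    (tArr (tNot (tNot (has_zero (tVar 0)))) (has_zero (tVar 0))).

(* Main.v *)
(* Both halves come from one realizability model, a Kripke family of partial
   equivalence relations on untyped terms.  For [MP] there are two worlds, as in
   modified realizability: in the "potential" world an error inhabits every type,
   the empty one included, and the "actual" world lies below it.  Computations in
   the potential world still terminate, so a realizer of [MP] applied to a function
   oracle that is constantly nonzero returns some number or an error, after finitely
   many queries.  It returns the same for a function that has a zero, but far out
   and elsewhere, which contradicts correctness in the actual world.  With the
   actual world alone, unbounded search realizes [MP], and [tNot MP] is refuted.
   Universes need only an inductively defined predicate at each level, because type
   equality is equality of the relations that interpret the types. *)

From Stdlib Require Import List Arith FunctionalExtensionality Lia Classical.
Require Import Defs.
Import ListNotations.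

(** * Substitution calculus *)

(** The oracle is a parameter of the evaluator and not of the syntax, so soundness applies to one
    closed term under every oracle; this is what lets a run be carried over from one oracle to
    another. The obstacle is termination: for a function without zeros, an actual world has no
    realizer of the double negation, so nothing there forces a realizer of [MP] to answer. The error
    closes this gap. The same argument [err] realizes the double negation at the potential world for
    every function, and at the actual world for every function that has a zero, so the two runs that
    are compared are runs of the same program. Excluded middle enters only in showing that the
    search meets a first zero. *)

Lemma up_ren_comp (r1 r2 : nat -> nat) :
  (fun n => up_ren r2 (up_ren r1 n)) = up_ren (fun n => r2 (r1 n)).
Proof. extensionality n; destruct n; reflexivity. Qed.

Lemma ren_ren (e : expr) : forall r1 r2,
  ren r2 (ren r1 e) = ren (fun n => r2 (r1 n)) e.
Proof.
  induction e; intros r1 r2; simpl; f_equal; auto;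
    rewrite ?IHe1, ?IHe2, ?IHe3, ?IHe; rewrite ?up_ren_comp; reflexivity.
Qed.

Lemma up_comp_ren (r : nat -> nat) (s : nat -> expr) :
  (fun n => up s (up_ren r n)) = up (fun n => s (r n)).
Proof. extensionality n; destruct n; reflexivity. Qed.

Lemma subst_ren (e : expr) : forall r s,
  subst s (ren r e) = subst (fun n => s (r n)) e.
Proof.
  induction e; intros r0 s0; simpl; f_equal; auto;
    rewrite ?IHe1, ?IHe2, ?IHe3, ?IHe; rewrite ?up_comp_ren; reflexivity.
Qed.

Lemma ren_comp_up (s : nat -> expr) (r : nat -> nat) :
  (fun n => ren (up_ren r) (up s n)) = up (fun n => ren r (s n)).
Proof.
  extensionality n; destruct n; simpl; [reflexivity|].
  unfold wk; rewrite !ren_ren; reflexivity.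
Qed.

Lemma ren_subst (e : expr) : forall s r,
  ren r (subst s e) = subst (fun n => ren r (s n)) e.
Proof.
  induction e; intros s0 r0; simpl; f_equal; auto;
    rewrite ?IHe1, ?IHe2, ?IHe3, ?IHe; rewrite ?ren_comp_up; reflexivity.
Qed.

Lemma up_comp (s1 s2 : nat -> expr) :
  (fun n => subst (up s2) (up s1 n)) = up (fun n => subst s2 (s1 n)).
Proof.
  extensionality n; destruct n; simpl; [reflexivity|].
  unfold wk; rewrite subst_ren, ren_subst; reflexivity.
Qed.

Lemma subst_subst (e : expr) : forall s1 s2,
  subst s2 (subst s1 e) = subst (fun n => subst s2 (s1 n)) e.
Proof.
  induction e; intros s1 s2; simpl; f_equal; auto;
    rewrite ?IHe1, ?IHe2, ?IHe3, ?IHe; rewrite ?up_comp; reflexivity.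
Qed.

Lemma up_tVar : up tVar = tVar.
Proof. extensionality n; destruct n; reflexivity. Qed.

Lemma subst_tVar (e : expr) : subst tVar e = e.
Proof. induction e; simpl; rewrite ?up_tVar; f_equal; auto. Qed.

Lemma subst_scons_wk (s : nat -> expr) (x e : expr) :
  subst (scons x s) (wk e) = subst s e.
Proof. unfold wk; rewrite subst_ren; reflexivity. Qed.

Lemma subst_wk (s : nat -> expr) (e : expr) :
  subst s (wk e) = subst (fun n => s (S n)) e.
Proof. unfold wk; rewrite subst_ren; reflexivity. Qed.

Lemma comp_up_scons (s s' : nat -> expr) (x : expr) :
  (fun n => subst (scons x s') (up s n)) =
  scons x (fun n => subst s' (s n)).
Proof.
  extensionality n; destruct n; simpl; [reflexivity|].
  apply subst_scons_wk.
Qed.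

Lemma subst_subst1 (s : nat -> expr) (a e : expr) :
  subst s (subst1 a e) = subst (scons (subst s a) s) e.
Proof.
  unfold subst1; rewrite subst_subst; f_equal.
  extensionality n; destruct n; reflexivity.
Qed.

(** Turns an instance of a substituted family into an extended environment, the form in which
    hypotheses over an extended context apply. *)
Lemma subst1_up (s : nat -> expr) (x e : expr) :
  subst1 x (subst (up s) e) = subst (scons x s) e.
Proof.
  unfold subst1; rewrite subst_subst, comp_up_scons; f_equal; f_equal.
  extensionality n; apply subst_tVar.
Qed.

Lemma subst_subst2 (s : nat -> expr) (b p e : expr) :
  subst s (subst2 b p e) = subst (scons (subst s p) (scons (subst s b) s)) e.
Proof.
  unfold subst2; rewrite subst_subst; f_equal.
  extensionality n; destruct n as [|[|n]]; reflexivity.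
Qed.

Lemma subst2_up (s : nat -> expr) (b p e : expr) :
  subst2 b p (subst (up (up s)) e) = subst (scons p (scons b s)) e.
Proof.
  unfold subst2; rewrite subst_subst, !comp_up_scons; do 3 f_equal.
  extensionality n; apply subst_tVar.
Qed.

Lemma subst_substS (s : nat -> expr) (r m e : expr) :
  subst (scons r (scons m s)) (substS e) = subst (scons (tSucc m) s) e.
Proof.
  unfold substS; rewrite subst_subst; f_equal.
  extensionality n; destruct n; reflexivity.
Qed.

(** * Realizers *)

Fixpoint num (n : nat) : expr :=
  match n with 0 => tZero | S m => tSucc (num m) end.

(** With [true] standing for [tB0], [o n = true] says that [n] is a zero of the oracle. *)
Definition dbool (b : bool) : expr := if b then tB0 else tB1.

(* The evaluator runs open terms and ignores annotations, so free variables
   serve as constants: [0] is an error, absorbed by every eliminator, [1]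
   searches for the first zero of a function, and [2 + k] is the shifted oracle
   [fun n => o (k + n)]. *)
Definition err : expr := tVar 0.
Definition srch : expr := tVar 1.
Definition orc (k : nat) : expr := tVar (S (S k)).

Definition app (f a : expr) : expr := tApp tEmpty tEmpty f a.
Definition pair (a b : expr) : expr := tPair tEmpty tEmpty a b.
Definition fst' (p : expr) : expr := tFst tEmpty tEmpty p.
Definition snd' (p : expr) : expr := tSnd tEmpty tEmpty p.
(** The common value of all reflexivity proofs: identity proofs carry no data. *)
Definition vrefl : expr := tRefl tEmpty tEmpty.

(* Codes evaluate to the types they code, and [tEl] and [tLift] are erased:
   this is what makes decoding and cumulativity strict. *)
Inductive eval (o : nat -> bool) : expr -> expr -> Prop :=
| ev_Var n : eval o (tVar n) (tVar n)
| ev_Pi A B : eval o (tPi A B) (tPi A B)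
| ev_Sig A B : eval o (tSig A B) (tSig A B)
| ev_Id A a b : eval o (tId A a b) (tId A a b)
| ev_Empty : eval o tEmpty tEmpty
| ev_Bool : eval o tBool tBool
| ev_Nat : eval o tNat tNat
| ev_U i : eval o (tU i) (tU i)
| ev_El i a v : eval o a v -> eval o (tEl i a) v
| ev_cPi i a b : eval o (cPi i a b) (tPi a b)
| ev_cSig i a b : eval o (cSig i a b) (tSig a b)
| ev_cId i a t u : eval o (cId i a t u) (tId a t u)
| ev_cEmpty i : eval o (cEmpty i) tEmpty
| ev_cBool i : eval o (cBool i) tBool
| ev_cNat i : eval o (cNat i) tNat
| ev_cU i : eval o (cU i) (tU i)
| ev_Lift i a v : eval o a v -> eval o (tLift i a) v
| ev_Lam A B t : eval o (tLam A B t) (tLam A B t)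
| ev_Pair A B a b : eval o (tPair A B a b) (tPair A B a b)
| ev_Refl A a : eval o (tRefl A a) vrefl
| ev_B0 : eval o tB0 tB0
| ev_B1 : eval o tB1 tB1
| ev_Zero : eval o tZero tZero
| ev_Succ n : eval o (tSucc n) (tSucc n)
| ev_App_Lam A B f a A' B' t v :
    eval o f (tLam A' B' t) -> eval o (subst1 a t) v ->
    eval o (tApp A B f a) v
| ev_App_err A B f a : eval o f err -> eval o (tApp A B f a) err
| ev_App_srch A B f a n :
    eval o f srch ->
    (forall m, m < n -> eval o (app a (num m)) tB1) ->
    eval o (app a (num n)) tB0 ->
    eval o (tApp A B f a) (tLam tEmpty tEmpty (pair (num n) vrefl))
| ev_App_orc_Zero A B f a k :
    eval o f (orc k) -> eval o a tZero -> eval o (tApp A B f a) (dbool (o k))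
| ev_App_orc_Succ A B f a k b v :
    eval o f (orc k) -> eval o a (tSucc b) -> eval o (app (orc (S k)) b) v ->
    eval o (tApp A B f a) v
| ev_App_orc_err A B f a k :
    eval o f (orc k) -> eval o a err -> eval o (tApp A B f a) err
| ev_Fst A B p A' B' a b v :
    eval o p (tPair A' B' a b) -> eval o a v -> eval o (tFst A B p) v
| ev_Fst_err A B p : eval o p err -> eval o (tFst A B p) err
| ev_Snd A B p A' B' a b v :
    eval o p (tPair A' B' a b) -> eval o b v -> eval o (tSnd A B p) v
| ev_Snd_err A B p : eval o p err -> eval o (tSnd A B p) err
| ev_J A a C d b p v :
    eval o p vrefl -> eval o d v -> eval o (tJ A a C d b p) v
| ev_J_err A a C d b p : eval o p err -> eval o (tJ A a C d b p) err
| ev_Abort_err C t : eval o t err -> eval o (tAbort C t) err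
| ev_If_B0 C c0 c1 t v :
    eval o t tB0 -> eval o c0 v -> eval o (tIf C c0 c1 t) v
| ev_If_B1 C c0 c1 t v :
    eval o t tB1 -> eval o c1 v -> eval o (tIf C c0 c1 t) v
| ev_If_err C c0 c1 t : eval o t err -> eval o (tIf C c0 c1 t) err
| ev_Natrec_Zero C z s n v :
    eval o n tZero -> eval o z v -> eval o (tNatrec C z s n) v
| ev_Natrec_Succ C z s n m v :
    eval o n (tSucc m) -> eval o (subst2 m (tNatrec C z s m) s) v ->
    eval o (tNatrec C z s n) v
| ev_Natrec_err C z s n : eval o n err -> eval o (tNatrec C z s n) err.

Ltac uneval :=
  match goal with
  | IH : forall v, eval ?o ?t v -> _ = v, H : eval ?o ?t _ |- _ =>
      pose proof (IH _ H); clear H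
  end.

Lemma eval_det (o : nat -> bool) (t v v' : expr) :
  eval o t v -> eval o t v' -> v = v'.
Proof.
  intros H; revert v'; induction H; intros w Hw; inversion Hw; subst; auto;
    repeat uneval; unfold err, srch, orc, vrefl in *; try congruence.
  all: try (repeat match goal with H : ?x = ?y |- _ =>
    first [constr_eq x y; clear H | injection H as; subst] end; now auto).
  (* Only search is left: of two different results, the smaller would be both a zero and a
     non-zero. *)
  assert (n = n0) as <-; [|reflexivity].
  destruct (Nat.lt_trichotomy n n0) as [Hl|[->|Hl]]; auto.
  - match goal with H : forall m, m < n0 -> eval _ _ _ |- _ =>
      specialize (H n Hl) end.
    repeat uneval; congruence.
  - match goal with H : forall m, m < n -> forall v, _ |- _ =>
      specialize (H n0 Hl) end.
    repeat uneval; congruence.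
Qed.

(** * Continuity in the oracle, for the topology of Cantor space *)

Definition near (o : nat -> bool) (P : (nat -> bool) -> Prop) : Prop :=
  exists k, forall o', (forall i, i < k -> o' i = o i) -> P o'.

Lemma near_all (o : nat -> bool) (P : (nat -> bool) -> Prop) :
  (forall o', P o') -> near o P.
Proof. exists 0; auto. Qed.

Lemma near_map (o : nat -> bool) (P Q : (nat -> bool) -> Prop) :
  (forall o', P o' -> Q o') -> near o P -> near o Q.
Proof. intros H [k Hk]; exists k; auto. Qed.

Lemma near_map2 (o : nat -> bool) (P Q R : (nat -> bool) -> Prop) :
  (forall o', P o' -> Q o' -> R o') -> near o P -> near o Q -> near o R.
Proof.
  intros H [k Hk] [l Hl]; exists (max k l); intros o' Ho.
  apply H; [apply Hk|apply Hl]; intros i Hi; apply Ho; lia.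
Qed.

(** The base case of continuity: an oracle applied to zero is the only place where evaluation looks
    at [o]. *)
Lemma near_query (o : nat -> bool) (k : nat) : near o (fun o' => o' k = o k).
Proof. exists (S k); auto. Qed.

(** Needed for search, whose rule has one premise for each number below the result. *)
Lemma near_bounded (o : nat -> bool) (P : nat -> (nat -> bool) -> Prop) (n : nat) :
  (forall m, m < n -> near o (P m)) ->
  near o (fun o' => forall m, m < n -> P m o').
Proof.
  induction n as [|n IH]; intros H.
  - apply near_all; intros; lia.
  - apply (near_map2 o (fun o' => forall m, m < n -> P m o') (P n)).
    + intros o' H1 H2 m Hm.
      destruct (Nat.eq_dec m n) as [->|]; [assumption|apply H1; lia].
    + apply IH; auto.
    + auto.
Qed.

(* A terminating evaluation queries the oracle finitely many times. *)
Lemma eval_continuous (o : nat -> bool) (t v : expr) :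
  eval o t v -> near o (fun o' => eval o' t v).
Proof.
  induction 1;
    try (apply near_all; intros; constructor; fail).
  all: try match goal with
    | H1 : near ?o ?P, H2 : near ?o ?Q |- _ =>
      apply (near_map2 o P Q); [intros; econstructor; eassumption | assumption..]
    | H1 : near ?o ?P |- _ =>
      apply (near_map o P); [intros; econstructor; eassumption | assumption..]
  end.
  - apply near_bounded in H1.
    refine (near_map2 o _ _ _ _ (near_map2 o _ _ _ _ IHeval1 H1) IHeval2);
      [|intros o' Ha Hb; exact (conj Ha Hb)].
    intros o' [Ha Hb] Hc; now constructor.
  - refine (near_map2 o _ _ _ _ (near_map2 o _ _ _ _ IHeval1 IHeval2)
      (near_query o k)); [|intros o' Ha Hb; exact (conj Ha Hb)].
    intros o' [Ha Hb] <-; now constructor.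
  - refine (near_map2 o _ _ _ _ (near_map2 o _ _ _ _ IHeval1 IHeval2)
      IHeval3); [|intros o' Ha Hb; exact (conj Ha Hb)].
    intros o' [Ha Hb] Hc; econstructor; eassumption.
Qed.

(* [reads o t n b]: [t] evaluates hereditarily to the numeral [n] if [b], and
   to [n] successors of an error otherwise. *)
Inductive reads (o : nat -> bool) : expr -> nat -> bool -> Prop :=
| reads_Zero t : eval o t tZero -> reads o t 0 true
| reads_err t : eval o t err -> reads o t 0 false
| reads_Succ t u n b :
    eval o t (tSucc u) -> reads o u n b -> reads o t (S n) b.

(** One evaluation per successor, hence still finitely many queries. Answers ending in an error are
    included, since a potential world may produce them. *)
Lemma reads_continuous (o : nat -> bool) (t : expr) (n : nat) (b : bool) :
  reads o t n b -> near o (fun o' => reads o' t n b).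
Proof.
  induction 1 as [t H|t H|t u n b H _ IH]; apply eval_continuous in H.
  - revert H; apply near_map; intros; now apply reads_Zero.
  - revert H; apply near_map; intros; now apply reads_err.
  - revert H IH; apply near_map2; intros; eapply reads_Succ; eassumption.
Qed.

Lemma reads_orc (o : nat -> bool) (t : expr) (n k : nat) :
  reads o t n true -> eval o (app (orc k) t) (dbool (o (k + n))).
Proof.
  intros H; remember true as b; revert k Heqb.
  induction H as [t H|t H|t u n b H _ IH]; intros k E; try discriminate.
  - rewrite Nat.add_0_r; eapply ev_App_orc_Zero; [constructor|assumption].
  - rewrite Nat.add_succ_r; eapply ev_App_orc_Succ; [constructor|eassumption|].
    now apply (IH (S k)).
Qed.

(** * Kripke PER model *)

Scheme wf_ctx_mut := Minimality for wf_ctx Sort Prop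
  with is_type_mut := Minimality for is_type Sort Prop
  with eq_type_mut := Minimality for eq_type Sort Prop
  with has_type_mut := Minimality for has_type Sort Prop
  with eq_term_mut := Minimality for eq_term Sort Prop.
Combined Scheme judgments_mut from
  wf_ctx_mut, is_type_mut, eq_type_mut, has_type_mut, eq_term_mut.

(* Following Kleene's and Kreisel's modified realizability, worlds come in two
   sorts: at the potential ones, closed upwards, the error inhabits every type. *)
Section Model.

Variable o : nat -> bool.
Variable W : Type.
Variable le : W -> W -> Prop.
Variable pot : W -> Prop.
Hypothesis le_refl : forall w, le w w.
Hypothesis le_trans : forall u v w, le u v -> le v w -> le u w.
Hypothesis pot_le : forall v w, le v w -> pot v -> pot w.

Notation eval := (eval o).

Definition fam : Type := W -> expr -> expr -> Prop.

Definition req (w : W) (R R' : fam) : Prop :=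
  forall v, le w v -> forall t t', R v t t' <-> R' v t t'.

(** Kleene equality: it also holds when neither term terminates. *)
Definition equiv (t t' : expr) : Prop := forall v, eval t v <-> eval t' v.

Definition ErrR : fam := fun w t t' => pot w /\ eval t err /\ eval t' err.

Definition BoolR : fam := fun w t t' =>
  (exists b, eval t (dbool b) /\ eval t' (dbool b)) \/ ErrR w t t'.

(** A successor is a value whatever its argument, so the relation has to descend below it. At
    potential worlds an error may sit at any depth. *)
Inductive NatR (w : W) : expr -> expr -> Prop :=
| NatR_Zero t t' : eval t tZero -> eval t' tZero -> NatR w t t'
| NatR_Succ t t' n n' :
    eval t (tSucc n) -> eval t' (tSucc n') -> NatR w n n' -> NatR w t t'
| NatR_err t t' : ErrR w t t' -> NatR w t t'.

(** At an actual world, being inhabited amounts to semantic equality of the end points. *)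
Definition IdR (R : fam) (a b : expr) : fam := fun w t t' =>
  (eval t vrefl /\ eval t' vrefl /\ R w a b) \/ ErrR w t t'.

(** Quantifying over later worlds gives monotonicity; an actual function thereby also has to act on
    the errors of potential worlds above it. *)
Definition PiR (R1 : fam) (R2 : expr -> fam) : fam := fun w f f' =>
  forall v x x', le w v -> R1 v x x' -> R2 x v (app f x) (app f' x').

Definition SigR (R1 : fam) (R2 : expr -> fam) : fam := fun w p p' =>
  R1 w (fst' p) (fst' p') /\ R2 (fst' p) w (snd' p) (snd' p').

(* [T Us w A R]: at world [w], [A] is a type whose equality is [R], given the
   equalities [Us i] of the universes.  Type equality will be equality of [R],
   so a unary predicate is enough. *)
Inductive T (Us : nat -> fam -> Prop) (w : W) (A : expr) (R : fam) : Prop :=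
| T_Pi A1 B1 R1 R2 :
    eval A (tPi A1 B1) -> T Us w A1 R1 ->
    (forall v x, le w v -> R1 v x x -> T Us v (subst1 x B1) (R2 x)) ->
    (forall v x x', le w v -> R1 v x x' -> req v (R2 x) (R2 x')) ->
    req w R (PiR R1 R2) -> T Us w A R
| T_Sig A1 B1 R1 R2 :
    eval A (tSig A1 B1) -> T Us w A1 R1 ->
    (forall v x, le w v -> R1 v x x -> T Us v (subst1 x B1) (R2 x)) ->
    (forall v x x', le w v -> R1 v x x' -> req v (R2 x) (R2 x')) ->
    req w R (SigR R1 R2) -> T Us w A R
| T_Id A1 a b R1 :
    eval A (tId A1 a b) -> T Us w A1 R1 -> R1 w a a -> R1 w b b ->
    req w R (IdR R1 a b) -> T Us w A R
| T_Empty : eval A tEmpty -> req w R ErrR -> T Us w A R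
| T_Bool : eval A tBool -> req w R BoolR -> T Us w A R
| T_Nat : eval A tNat -> req w R NatR -> T Us w A R
| T_U i R0 : eval A (tU i) -> Us i R0 -> req w R R0 -> T Us w A R
| T_err : pot w -> eval A err -> req w R ErrR -> T Us w A R.

Definition eqt (Us : nat -> fam -> Prop) (w : W) (A A' : expr) : Prop :=
  exists R, T Us w A R /\ T Us w A' R.

(** Stage [n] offers the universes below [n]. The relation of the topmost one is type equality over
    the stage before, so recursion on the level replaces induction-recursion. *)
Fixpoint Un (n : nat) (i : nat) (R : fam) : Prop :=
  match n with
  | 0 => False
  | S m => Un m i R \/ (i = m /\ R = eqt (Un m))
  end.

Definition Uall (i : nat) (R : fam) : Prop := exists n, Un n i R.

(** An existential instead of a chosen relation: by [T_uniq] all candidates agree, so [A] alone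
    determines its equality. *)
Definition el (A : expr) : fam := fun w t t' =>
  exists R, T Uall w A R /\ R w t t'.

(** Saturation under Kleene equality is asked on the left only, as symmetry gives the other side.
    [good_err] is the clause that comes from modified realizability. *)
Record good (w : W) (R : fam) : Prop := {
  good_sym v t t' : le w v -> R v t t' -> R v t' t;
  good_trans v t t' t'' : le w v -> R v t t' -> R v t' t'' -> R v t t'';
  good_equiv v s t t' : le w v -> equiv s t -> R v t t' -> R v s t';
  good_le u v t t' : le w v -> le v u -> R v t t' -> R u t t';
  good_err v : le w v -> pot v -> R v err err }.

Definition goodU (Us : nat -> fam -> Prop) : Prop :=
  (forall i R, Us i R -> forall w, good w R) /\
  (forall i R R', Us i R -> Us i R' -> R = R').

Ltac det :=
  match goal with
  | H1 : eval ?t ?v, H2 : eval ?t ?v' |- _ =>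
      first [constr_eq v v'; clear H2 |
        let E := fresh in pose proof (eval_det o t v v' H1 H2) as E;
        first [discriminate E | injection E as; subst; clear H2]]
  end.

(** * Agreement of relations and Kleene equality of terms *)

Lemma req_refl (w : W) (R : fam) : req w R R.
Proof. intros ? ? ? ?; tauto. Qed.

Lemma req_sym (w : W) (R R' : fam) : req w R R' -> req w R' R.
Proof. intros H v Hv t t'; rewrite (H v Hv t t'); tauto. Qed.

Lemma req_trans (w : W) (R R' R'' : fam) :
  req w R R' -> req w R' R'' -> req w R R''.
Proof.
  intros H H' v Hv t t'; rewrite (H v Hv t t'), (H' v Hv t t'); tauto.
Qed.

Lemma req_le (w v : W) (R R' : fam) : le w v -> req w R R' -> req v R R'.
Proof. intros Hv H u Hu; apply H; eauto. Qed.

Lemma equiv_refl (t : expr) : equiv t t.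
Proof. intros v; tauto. Qed.

Lemma equiv_sym (t t' : expr) : equiv t t' -> equiv t' t.
Proof. intros H v; rewrite (H v); tauto. Qed.

Lemma equiv_trans (t t' t'' : expr) : equiv t t' -> equiv t' t'' -> equiv t t''.
Proof. intros H H' v; rewrite (H v); apply H'. Qed.

Lemma equiv_app (A B A' B' f f' a : expr) :
  equiv f f' -> equiv (tApp A B f a) (tApp A' B' f' a).
Proof.
  assert (forall C D C' D' g g', equiv g g' ->
    forall v, eval (tApp C D g a) v -> eval (tApp C' D' g' a) v) as X.
  { intros C D C' D' g g' H v Hv; inversion Hv; subst;
      match goal with H0 : eval g _ |- _ => apply H in H0 end;
      econstructor; eassumption. }
  intros H v; split; apply X; auto using equiv_sym.
Qed.

Lemma equiv_fst (A B A' B' p p' : expr) :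
  equiv p p' -> equiv (tFst A B p) (tFst A' B' p').
Proof.
  assert (forall C D C' D' q q', equiv q q' ->
    forall v, eval (tFst C D q) v -> eval (tFst C' D' q') v) as X.
  { intros C D C' D' q q' H v Hv; inversion Hv; subst;
      match goal with H0 : eval q _ |- _ => apply H in H0 end;
      econstructor; eassumption. }
  intros H v; split; apply X; auto using equiv_sym.
Qed.

Lemma equiv_snd (A B A' B' p p' : expr) :
  equiv p p' -> equiv (tSnd A B p) (tSnd A' B' p').
Proof.
  assert (forall C D C' D' q q', equiv q q' ->
    forall v, eval (tSnd C D q) v -> eval (tSnd C' D' q') v) as X.
  { intros C D C' D' q q' H v Hv; inversion Hv; subst;
      match goal with H0 : eval q _ |- _ => apply H in H0 end;
      econstructor; eassumption. }
  intros H v; split; apply X; auto using equiv_sym.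
Qed.

Lemma equiv_eval (t v : expr) : eval t v -> eval v v -> equiv t v.
Proof.
  intros H1 H2 u; split; intros H.
  - now rewrite <- (eval_det o t v u H1 H).
  - now rewrite <- (eval_det o v v u H2 H).
Qed.

Lemma equiv_app_Lam (A B A' B' t a : expr) :
  equiv (tApp A B (tLam A' B' t) a) (subst1 a t).
Proof.
  intros v; split; intros H.
  - assert (eval (tLam A' B' t) (tLam A' B' t)) by constructor.
    inversion H; subst; repeat det; assumption.
  - econstructor; [constructor|eassumption].
Qed.

Lemma equiv_fst_Pair (A B A' B' a b : expr) :
  equiv (tFst A B (tPair A' B' a b)) a.
Proof.
  intros v; split; intros H.
  - assert (eval (tPair A' B' a b) (tPair A' B' a b)) by constructor.
    inversion H; subst; repeat det; assumption.
  - econstructor; [constructor|eassumption].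
Qed.

Lemma equiv_snd_Pair (A B A' B' a b : expr) :
  equiv (tSnd A B (tPair A' B' a b)) b.
Proof.
  intros v; split; intros H.
  - assert (eval (tPair A' B' a b) (tPair A' B' a b)) by constructor.
    inversion H; subst; repeat det; assumption.
  - econstructor; [constructor|eassumption].
Qed.

Lemma equiv_El (i : nat) (a : expr) : equiv (tEl i a) a.
Proof.
  intros v; split; intros H; [inversion H; assumption|now constructor].
Qed.

Lemma equiv_Lift (i : nat) (a : expr) : equiv (tLift i a) a.
Proof.
  intros v; split; intros H; [inversion H; assumption|now constructor].
Qed.

Lemma T_req (Us : nat -> fam -> Prop) (w : W) (A : expr) (R R' : fam) :
  T Us w A R -> req w R' R -> T Us w A R'.
Proof.
  destruct 1; intros; [eapply T_Pi|eapply T_Sig|eapply T_Id|eapply T_Empty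
    |eapply T_Bool|eapply T_Nat|eapply T_U|eapply T_err];
    eauto using req_trans.
Qed.

Lemma T_equiv (Us : nat -> fam -> Prop) (w : W) (A A' : expr) (R : fam) :
  T Us w A R -> equiv A' A -> T Us w A' R.
Proof.
  intros H E; destruct H; [eapply T_Pi|eapply T_Sig|eapply T_Id|eapply T_Empty
    |eapply T_Bool|eapply T_Nat|eapply T_U|eapply T_err];
    solve [apply E; eassumption | eassumption].
Qed.

Lemma T_sub (Us Vs : nat -> fam -> Prop) (w : W) (A : expr) (R : fam) :
  (forall i R, Us i R -> Vs i R) -> T Us w A R -> T Vs w A R.
Proof.
  intros Hs; induction 1; [eapply T_Pi|eapply T_Sig|eapply T_Id|eapply T_Empty
    |eapply T_Bool|eapply T_Nat|eapply T_U|eapply T_err]; eauto.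
Qed.

(** * Closure properties of the element relations *)

Lemma good_ErrR (w : W) : good w ErrR.
Proof.
  split; unfold ErrR; intros.
  - tauto.
  - tauto.
  - rewrite (H0 err); assumption.
  - intuition eauto.
  - repeat split; [assumption|constructor..].
Qed.

Lemma good_BoolR (w : W) : good w BoolR.
Proof.
  split; unfold BoolR.
  - intros v t t' Hv [[b []]|H]; [eauto|].
    right; eapply good_sym; eauto using good_ErrR.
  - intros v t t' t'' Hv [[b []]|(Hp & H1 & H2)] [[c []]|(Hp' & H1' & H2')].
    + assert (dbool b = dbool c) as E by (eapply eval_det; eassumption).
      left; exists c; rewrite <- E in *; auto.
    + destruct b; det.
    + destruct c; det.
    + right; repeat split; assumption.
  - intros v s t t' Hv E [[b []]|H].
    + left; exists b; rewrite (E _); auto.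
    + right; eapply good_equiv; eauto using good_ErrR.
  - intros u v t t' Hv Hu [?|H]; [auto|].
    right; eapply good_le; [apply (good_ErrR w)|..]; eauto.
  - intros v Hv Hp; right; eapply good_err; eauto using good_ErrR.
Qed.

Lemma good_NatR (w : W) : good w NatR.
Proof.
  split.
  - intros v t t' Hv; induction 1; [now apply NatR_Zero|
      eapply NatR_Succ; eassumption|].
    apply NatR_err; eapply good_sym; eauto using good_ErrR.
  - intros v t t' t'' Hv H; revert t''.
    induction H as [t t' H1 H2|t t' n n' H1 H2 _ IH|t t' (Hp & H1 & H2)];
      intros t''; inversion 1 as [? ? H3 H4|? ? m m' H3 H4 H5|? ? (Hp' & H3 & H4)];
      subst; try det.
    + now apply NatR_Zero.
    + eapply NatR_Succ; eauto.
    + apply NatR_err; repeat split; assumption.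
  - intros v s t t' Hv E.
    destruct 1 as [t t' H1 H2|t t' n n' H1 H2 H3|t t' H].
    + apply NatR_Zero; [now apply E|assumption].
    + eapply NatR_Succ; [now apply E; eassumption|eassumption..].
    + apply NatR_err; eapply good_equiv; eauto using good_ErrR.
  - intros u v t t' Hv Hu; induction 1; [now apply NatR_Zero|
      eapply NatR_Succ; eassumption|].
    apply NatR_err; eapply good_le; [apply (good_ErrR w)|..]; eauto.
  - intros v Hv Hp; apply NatR_err; eapply good_err; eauto using good_ErrR.
Qed.

Lemma good_IdR (w : W) (R : fam) (a b : expr) : good w R -> good w (IdR R a b).
Proof.
  intros HR; split; unfold IdR.
  - intros v t t' Hv [?|H]; [tauto|].
    right; eapply good_sym; eauto using good_ErrR.
  - intros v t t' t'' Hv [(? & ? & ?)|(Hp & H1 & H2)]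
      [(? & ? & ?)|(Hp' & H1' & H2')].
    + auto.
    + det.
    + det.
    + right; repeat split; assumption.
  - intros v s t t' Hv E [?|H].
    + rewrite (E _); auto.
    + right; eapply good_equiv; eauto using good_ErrR.
  - intros u v t t' Hv Hu [(? & ? & ?)|H].
    + left; repeat split; auto; eapply good_le; eauto.
    + right; eapply good_le; [apply (good_ErrR w)|..]; eauto.
  - intros v Hv Hp; right; eapply good_err; eauto using good_ErrR.
Qed.

Lemma good_refl (w v : W) (R : fam) (t t' : expr) :
  good w R -> le w v -> R v t t' -> R v t t.
Proof. intros G Hv H; eapply good_trans; eauto; eapply good_sym; eauto. Qed.

Lemma good_world (w v : W) (R : fam) : le w v -> good w R -> good v R.
Proof. intros Hv []; split; eauto. Qed.

Lemma good_req (w : W) (R R' : fam) : req w R' R -> good w R -> good w R'.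
Proof.
  intros E []; split; intros; repeat match goal with
    | H : R' _ _ _ |- _ => apply E in H; [|now eauto]
    end; apply E; eauto.
Qed.

Lemma equiv_app_err (A B a : expr) : equiv (tApp A B err a) err.
Proof. apply equiv_eval; repeat constructor. Qed.

Lemma equiv_fst_err (A B : expr) : equiv (tFst A B err) err.
Proof. apply equiv_eval; [apply ev_Fst_err|]; constructor. Qed.

Lemma equiv_snd_err (A B : expr) : equiv (tSnd A B err) err.
Proof. apply equiv_eval; [apply ev_Snd_err|]; constructor. Qed.

Section Family.

Variables (w : W) (R1 : fam) (R2 : expr -> fam).
Hypothesis good1 : good w R1.
Hypothesis good2 : forall v x, le w v -> R1 v x x -> good v (R2 x).
Hypothesis ext2 :
  forall v x x', le w v -> R1 v x x' -> req v (R2 x) (R2 x').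

Lemma good_PiR : good w (PiR R1 R2).
Proof.
  split; unfold PiR.
  - intros v f f' Hv H u x x' Hu Hx.
    assert (le w u) by eauto.
    assert (R1 u x' x) as Hx' by (eapply good_sym; eauto).
    apply (ext2 u x x'); auto.
    eapply good_sym; [apply (good2 u x')| |]; auto.
    eapply good_refl; eauto.
  - intros v f f' f'' Hv H H' u x x' Hu Hx.
    assert (le w u) by eauto.
    assert (R1 u x x) by (eapply good_refl; eauto).
    eapply good_trans; [apply (good2 u x)|..]; eauto.
  - intros v s f f' Hv E H u x x' Hu Hx.
    assert (le w u) by eauto.
    eapply good_equiv; [apply (good2 u x)| |apply equiv_app, E|]; eauto.
    eapply good_refl; eauto.
  - intros u v f f' Hv Hu H u' x x' Hu' Hx; eauto.
  (* Application absorbs the error, so [err] is a function as soon as it inhabits every fibre. *)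
  - intros v Hv Hp u x x' Hu Hx.
    assert (le w u) by eauto.
    assert (R1 u x x) by (eapply good_refl; eauto).
    assert (good u (R2 x)) as G by eauto.
    apply (good_equiv u _ G u _ err); [auto|apply equiv_app_err|].
    apply (good_sym u _ G); [auto|].
    apply (good_equiv u _ G u _ err); [auto|apply equiv_app_err|].
    eapply good_err; eauto.
Qed.

Lemma good_SigR : good w (SigR R1 R2).
Proof.
  split; unfold SigR.
  - intros v p p' Hv [H1 H2]; split; [eapply good_sym; eauto|].
    apply (ext2 v (fst' p) (fst' p')); auto.
    eapply good_sym; [apply (good2 v (fst' p))|..]; auto.
    eapply good_refl; eauto.
  - intros v p p' p'' Hv [H1 H2] [H1' H2']; split; [eapply good_trans; eauto|].
    eapply good_trans; [apply (good2 v (fst' p))|..]; eauto.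
    + eapply good_refl; eauto.
    + apply (ext2 v (fst' p) (fst' p')); auto.
  - intros v s p p' Hv E [H1 H2].
    assert (R1 v (fst' s) (fst' p')) as H1'.
    { exact (good_equiv w R1 good1 v _ _ _ Hv (equiv_fst _ _ _ _ _ _ E) H1). }
    split; [assumption|].
    apply (ext2 v (fst' s) (fst' p)); auto.
    + eapply (good_trans w R1 good1 v _ (fst' p')); auto.
      eapply good_sym; eauto.
    + refine (good_equiv v (R2 (fst' p)) _ v _ _ _ _
        (equiv_snd _ _ _ _ _ _ E) H2); auto.
      apply good2; [auto|eapply good_refl; eauto].
  - intros u v p p' Hv Hu [H1 H2]; split; [eapply good_le; eauto|].
    refine (good_le v (R2 (fst' p)) _ u v _ _ _ _ H2); auto.
    apply good2; [auto|eapply good_refl; eauto].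
  - intros v Hv Hp.
    assert (forall R t, good v R -> equiv t err -> R v t t) as X.
    { intros R t G E; apply (good_equiv v _ G v t err t); auto.
      apply (good_sym v _ G); auto.
      apply (good_equiv v _ G v t err err); auto.
      eapply good_err; eauto. }
    assert (R1 v (fst' err) (fst' err)).
    { apply X; [|apply equiv_fst_err]; eauto using good_world. }
    split; [assumption|].
    apply X; [auto|apply equiv_snd_err].
Qed.

End Family.

Lemma T_good (Us : nat -> fam -> Prop) (w : W) (A : expr) (R : fam) :
  goodU Us -> T Us w A R -> good w R.
Proof.
  intros [HU _]; induction 1;
    (eapply good_req; [eassumption|]);
    eauto using good_PiR, good_SigR, good_IdR, good_ErrR, good_BoolR, good_NatR.
Qed.

Lemma T_le (Us : nat -> fam -> Prop) (w v : W) (A : expr) (R : fam) :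
  goodU Us -> le w v -> T Us w A R -> T Us v A R.
Proof.
  intros HU Hv H; revert v Hv; induction H; intros u Hu.
  - eapply T_Pi; eauto using req_le.
  - eapply T_Sig; eauto using req_le.
  - assert (good w R1) as G by (eapply T_good; eauto).
    eapply T_Id; eauto using req_le; eapply (good_le w R1 G u w); eauto.
  - apply T_Empty; eauto using req_le.
  - apply T_Bool; eauto using req_le.
  - apply T_Nat; eauto using req_le.
  - eapply T_U; eauto using req_le.
  - apply T_err; eauto using req_le.
Qed.

Lemma PiR_req (w : W) (R1 R1' : fam) (R2 R2' : expr -> fam) :
  good w R1 -> req w R1 R1' ->
  (forall v x, le w v -> R1 v x x -> req v (R2 x) (R2' x)) ->
  req w (PiR R1 R2) (PiR R1' R2').
Proof.
  intros G E1 E2 v Hv f f'; split; intros H u x x' Hu Hx.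
  - apply E1 in Hx; eauto.
    apply (E2 u x); eauto; eapply good_refl; eauto.
  - apply (E2 u x); [eauto|eapply good_refl; eauto|eauto|].
    apply H; auto; apply E1; eauto.
Qed.

Lemma SigR_req (w : W) (R1 R1' : fam) (R2 R2' : expr -> fam) :
  good w R1 -> req w R1 R1' ->
  (forall v x, le w v -> R1 v x x -> req v (R2 x) (R2' x)) ->
  req w (SigR R1 R2) (SigR R1' R2').
Proof.
  intros G E1 E2 v Hv p p'; unfold SigR.
  rewrite <- (E1 v Hv (fst' p) (fst' p')).
  split; intros [H1 H2]; (split; [assumption|]);
    apply (E2 v (fst' p)); eauto; eapply good_refl; eauto.
Qed.

(** By determinism of evaluation both derivations end with the same clause; for universes the second
    half of [goodU] applies. *)
Lemma T_uniq (Us : nat -> fam -> Prop) (w : W) (A : expr) (R R' : fam) :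
  goodU Us -> T Us w A R -> T Us w A R' -> req w R R'.
Proof.
  intros HU H; revert R'; induction H; intros R'; inversion 1; subst;
    det; (eapply req_trans; [eassumption|]);
    (eapply req_trans; [|eapply req_sym; eassumption]); try apply req_refl.
  - assert (req w R1 R0) as E by auto.
    apply PiR_req; eauto using T_good.
    intros v x Hv Hx; apply H2; auto.
    apply H8; auto; now apply E.
  - assert (req w R1 R0) as E by auto.
    apply SigR_req; eauto using T_good.
    intros v x Hv Hx; apply H2; auto.
    apply H8; auto; now apply E.
  - intros v Hv t t'; unfold IdR; rewrite (IHT _ H6 v Hv _ _); tauto.
  - match goal with H1 : Us ?i _, H2 : Us ?i _ |- _ =>
      rewrite (proj2 HU _ _ _ H1 H2) end.
    apply req_refl.
Qed.

(** Transitivity meets two relations for the middle type and needs [T_uniq]. The clause [T_err]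
    makes the error a type, as [good_err] requires of a universe. *)
Lemma good_eqt (Us : nat -> fam -> Prop) (w : W) : goodU Us -> good w (eqt Us).
Proof.
  intros HU; split; unfold eqt.
  - intros v t t' _ (R & H1 & H2); eauto.
  - intros v t t' t'' _ (R & H1 & H2) (R' & H3 & H4).
    exists R; split; [assumption|].
    eapply T_req; [eassumption|]; eapply T_uniq; eassumption.
  - intros v s t t' _ E (R & H1 & H2); eauto using T_equiv.
  - intros u v t t' _ Hu (R & H1 & H2); eauto using T_le.
  - intros v _ Hp; exists ErrR; split; apply T_err; auto using req_refl; constructor.
Qed.

(** * The tower of universes *)

Lemma Un_spec (n i : nat) (R : fam) : Un n i R <-> i < n /\ R = eqt (Un i).
Proof.
  induction n as [|n IH]; simpl; [intuition lia|].
  rewrite IH; split.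
  - intros [[H ->]|[-> ->]]; auto with arith.
  - intros [H ->]; destruct (Nat.eq_dec i n) as [->|]; [auto|].
    left; split; [lia|reflexivity].
Qed.

(** Strong induction works because the relation of universe [i] is type equality over the earlier
    stage [Un i]. *)
Lemma goodU_Un (n : nat) : goodU (Un n).
Proof.
  induction n as [n IH] using lt_wf_ind; split.
  - intros i R H w; apply Un_spec in H as [H ->]; auto using good_eqt.
  - intros i R R' H H'; apply Un_spec in H, H'; destruct H, H'; congruence.
Qed.

Lemma goodU_Uall : goodU Uall.
Proof.
  split.
  - intros i R [n H]; exact (proj1 (goodU_Un n) i R H).
  - intros i R R' [n H] [n' H']; apply Un_spec in H, H'; destruct H, H'; congruence.
Qed.

(** Codes live over a stage [Un i], while [el] is computed over [Uall]; lemmas under this condition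
    cover both. *)
Definition subU (Us : nat -> fam -> Prop) : Prop :=
  forall i R, Us i R -> Uall i R.

Lemma subU_Un (n : nat) : subU (Un n).
Proof. intros i R; exists n; assumption. Qed.

Lemma subU_Uall : subU Uall.
Proof. intros i R; auto. Qed.

Lemma subU_good (Us : nat -> fam -> Prop) : subU Us -> goodU Us.
Proof. intros H; split; intros; eapply goodU_Uall; eauto. Qed.

Hint Resolve subU_Un subU_Uall subU_good goodU_Uall req_refl le_refl : core.

(** Adding universes does not change the elements of a type, by uniqueness over [Uall]. *)
Lemma el_req (Us : nat -> fam -> Prop) (w : W) (A : expr) (R : fam) :
  subU Us -> T Us w A R -> req w (el A) R.
Proof.
  intros HU H v Hv t t'; split.
  - intros (R' & H1 & H2).
    refine (proj1 (T_uniq Uall v A R' R _ H1 _ v (le_refl v) t t') H2); auto.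
    eapply T_le; eauto using T_sub.
  - intros H'; exists R; split; [eapply T_le; eauto using T_sub|assumption].
Qed.

Lemma T_el (Us : nat -> fam -> Prop) (w : W) (A : expr) (R : fam) :
  subU Us -> T Us w A R -> T Us w A (el A).
Proof. intros; eapply T_req; eauto using el_req. Qed.

Lemma el_T (w : W) (A t t' : expr) : el A w t t' -> T Uall w A (el A).
Proof. intros (R & H & _); eauto using T_el. Qed.

Lemma eqt_req (Us : nat -> fam -> Prop) (w : W) (A A' : expr) :
  subU Us -> eqt Us w A A' -> req w (el A) (el A').
Proof.
  intros HU (R & H & H'); eauto using req_trans, req_sym, el_req.
Qed.

Lemma eqt_T (Us : nat -> fam -> Prop) (w : W) (A A' : expr) :
  subU Us -> eqt Us w A A' -> T Us w A (el A).
Proof. intros HU (R & H & H'); eauto using T_el. Qed.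

Lemma T_eqt (Us : nat -> fam -> Prop) (w : W) (A A' : expr) (R R' : fam) :
  T Us w A R -> T Us w A' R' -> req w R R' -> eqt Us w A A'.
Proof. intros H H' E; exists R; eauto using T_req. Qed.

Lemma eqt_sym (Us : nat -> fam -> Prop) (w : W) (A A' : expr) :
  eqt Us w A A' -> eqt Us w A' A.
Proof. intros (R & H & H'); exists R; auto. Qed.

Lemma eqt_trans (Us : nat -> fam -> Prop) (w : W) (A A' A'' : expr) :
  subU Us -> eqt Us w A A' -> eqt Us w A' A'' -> eqt Us w A A''.
Proof.
  intros HU; apply (good_trans w _ (good_eqt Us w (subU_good Us HU))); auto.
Qed.

Lemma eqt_sub (Us : nat -> fam -> Prop) (w : W) (A A' : expr) :
  subU Us -> eqt Us w A A' -> eqt Uall w A A'.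
Proof. intros HU (R & H & H'); exists R; eauto using T_sub. Qed.

Lemma eqt_equiv (Us : nat -> fam -> Prop) (w : W) (A A' B B' : expr) :
  equiv B A -> equiv B' A' -> eqt Us w A A' -> eqt Us w B B'.
Proof. intros E E' (R & H & H'); exists R; eauto using T_equiv. Qed.

Lemma good_el (w : W) (A : expr) (R : fam) : T Uall w A R -> good w (el A).
Proof. intros H; apply (good_req w R); eauto using el_req, T_good. Qed.

Lemma el_eqt (w : W) (A A' t t' : expr) :
  eqt Uall w A A' -> el A w t t' -> el A' w t t'.
Proof. intros H; apply (eqt_req Uall w A A'); auto. Qed.

Lemma el_sym (w : W) (A t t' : expr) : el A w t t' -> el A w t' t.
Proof. intros H; eapply good_sym; eauto using good_el, el_T. Qed.

Lemma el_trans (w : W) (A t t' t'' : expr) :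
  el A w t t' -> el A w t' t'' -> el A w t t''.
Proof. intros H H'; eapply good_trans; eauto using good_el, el_T. Qed.

Lemma el_equiv (w : W) (A t t' s s' : expr) :
  equiv s t -> equiv s' t' -> el A w t t' -> el A w s s'.
Proof.
  intros E E' H.
  assert (good w (el A)) as G by eauto using good_el, el_T.
  apply (good_equiv w _ G w s t s'); auto.
  apply el_sym, (good_equiv w _ G w s' t' t); auto using el_sym.
Qed.

Lemma el_le (w v : W) (A t t' : expr) : le w v -> el A w t t' -> el A v t t'.
Proof.
  intros Hv H.
  assert (good w (el A)) as G by eauto using good_el, el_T.
  apply (good_le w _ G v w); auto.
Qed.

Lemma el_err (w : W) (A t t' : expr) (R : fam) :
  T Uall w A R -> pot w -> eval t err -> eval t' err -> el A w t t'.
Proof.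
  intros H Hp Ht Ht'.
  apply (el_equiv w A err err); try (apply equiv_eval; [assumption|constructor]).
  eapply good_err; eauto using good_el.
Qed.

Lemma el_U (i : nat) (X : expr) (w : W) :
  eval X (tU i) -> req w (el X) (eqt (Un i)).
Proof.
  intros E; apply (el_req Uall); auto.
  eapply T_U; [eassumption| |apply req_refl].
  exists (S i); simpl; auto.
Qed.

Lemma el_Empty (w : W) : req w (el tEmpty) ErrR.
Proof. apply (el_req Uall); auto; apply T_Empty; auto; constructor. Qed.

Lemma el_Bool (w : W) : req w (el tBool) BoolR.
Proof. apply (el_req Uall); auto; apply T_Bool; auto; constructor. Qed.

Lemma el_Nat (w : W) : req w (el tNat) NatR.
Proof. apply (el_req Uall); auto; apply T_Nat; auto; constructor. Qed.

(** Whatever [R1] and [R2] a derivation picked for domain and family, uniqueness turns them into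
    [el]. *)
Lemma el_Pi (w : W) (A B X : expr) (R : fam) :
  eval X (tPi A B) -> T Uall w X R ->
  req w (el X) (PiR (el A) (fun x => el (subst1 x B))).
Proof.
  intros E H; apply (req_trans w _ R); [eauto using el_req|].
  inversion H; subst; det.
  eapply req_trans; [eassumption|].
  apply PiR_req; eauto using T_good, req_sym, el_req.
Qed.

Lemma el_Sig (w : W) (A B X : expr) (R : fam) :
  eval X (tSig A B) -> T Uall w X R ->
  req w (el X) (SigR (el A) (fun x => el (subst1 x B))).
Proof.
  intros E H; apply (req_trans w _ R); [eauto using el_req|].
  inversion H; subst; det.
  eapply req_trans; [eassumption|].
  apply SigR_req; eauto using T_good, req_sym, el_req.
Qed.

Lemma el_Id (w : W) (A a b X : expr) (R : fam) :
  eval X (tId A a b) -> T Uall w X R ->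
  req w (el X) (IdR (el A) a b).
Proof.
  intros E H; apply (req_trans w _ R); [eauto using el_req|].
  inversion H; subst; det.
  eapply req_trans; [eassumption|].
  intros v Hv t t'; unfold IdR.
  match goal with H1 : T Uall w _ ?R1, _ : req w R (IdR ?R1 _ _) |- _ =>
    rewrite (el_req Uall w _ _ subU_Uall H1 v Hv _ _) end; tauto.
Qed.

(** * Equality of compound types *)

(** The hypothesis compares [B] with [B'] across related arguments; a detour through [B'] makes [B]
    itself extensional, and the diagonal makes the two families agree. *)
Lemma eqt_family (Us : nat -> fam -> Prop) (w : W) (A A' B B' : expr) :
  subU Us -> eqt Us w A A' ->
  (forall v x x', le w v -> el A v x x' ->
    eqt Us v (subst1 x B) (subst1 x' B')) ->
  (forall v x, le w v -> el A v x x -> T Us v (subst1 x B) (el (subst1 x B))) /\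
  (forall v x x', le w v -> el A v x x' ->
    req v (el (subst1 x B)) (el (subst1 x' B))) /\
  (forall v x, le w v -> el A v x x ->
    req v (el (subst1 x B)) (el (subst1 x B'))).
Proof.
  intros HU HA HB.
  assert (good w (el A)) as G
    by (eapply good_el; eapply eqt_T; eauto using eqt_sub).
  split; [|split].
  - intros v x Hv Hx; eapply eqt_T; eauto.
  - intros v x x' Hv Hx.
    apply (req_trans v _ (el (subst1 x' B'))); [eapply eqt_req; eauto|].
    eapply req_sym, eqt_req; [exact HU|apply HB; auto].
    apply (good_refl w v (el A) x' x); auto using el_sym.
  - intros; eapply eqt_req; eauto.
Qed.

Lemma eqt_family_sym (Us : nat -> fam -> Prop) (w : W) (A A' B B' : expr) :
  subU Us -> eqt Us w A A' ->
  (forall v x x', le w v -> el A v x x' ->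
    eqt Us v (subst1 x B) (subst1 x' B')) ->
  forall v x x', le w v -> el A' v x x' ->
    eqt Us v (subst1 x B') (subst1 x' B).
Proof.
  intros HU HA HB v x x' Hv Hx; apply eqt_sym, HB; auto.
  apply (eqt_req Us w A A' HU HA v Hv), el_sym, Hx.
Qed.

(** [X] and [X'] need only evaluate to products, so this covers types, codes, decoded codes and
    lifted codes. *)
Lemma eqt_Pi (Us : nat -> fam -> Prop) (w : W) (A A' B B' X X' : expr) :
  subU Us -> eval X (tPi A B) -> eval X' (tPi A' B') ->
  eqt Us w A A' ->
  (forall v x x', le w v -> el A v x x' ->
    eqt Us v (subst1 x B) (subst1 x' B')) ->
  eqt Us w X X'.
Proof.
  intros HU E E' HA HB.
  destruct (eqt_family _ _ _ _ _ _ HU HA HB) as (H1 & H2 & H3).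
  destruct (eqt_family _ _ _ _ _ _ HU (eqt_sym _ _ _ _ HA)
    (eqt_family_sym _ _ _ _ _ _ HU HA HB)) as (H1' & H2' & _).
  apply (T_eqt _ _ _ _ (PiR (el A) (fun x => el (subst1 x B)))
    (PiR (el A') (fun x => el (subst1 x B')))).
  - apply (T_Pi Us w X _ A B (el A) (fun x => el (subst1 x B)));
      eauto using eqt_T.
  - apply (T_Pi Us w X' _ A' B' (el A') (fun x => el (subst1 x B')));
      eauto using eqt_T, eqt_sym.
  - apply PiR_req; eauto using eqt_req.
    eapply good_el; eapply eqt_T; eauto using eqt_sub.
Qed.

Lemma eqt_Sig (Us : nat -> fam -> Prop) (w : W) (A A' B B' X X' : expr) :
  subU Us -> eval X (tSig A B) -> eval X' (tSig A' B') ->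
  eqt Us w A A' ->
  (forall v x x', le w v -> el A v x x' ->
    eqt Us v (subst1 x B) (subst1 x' B')) ->
  eqt Us w X X'.
Proof.
  intros HU E E' HA HB.
  destruct (eqt_family _ _ _ _ _ _ HU HA HB) as (H1 & H2 & H3).
  destruct (eqt_family _ _ _ _ _ _ HU (eqt_sym _ _ _ _ HA)
    (eqt_family_sym _ _ _ _ _ _ HU HA HB)) as (H1' & H2' & _).
  apply (T_eqt _ _ _ _ (SigR (el A) (fun x => el (subst1 x B)))
    (SigR (el A') (fun x => el (subst1 x B')))).
  - apply (T_Sig Us w X _ A B (el A) (fun x => el (subst1 x B)));
      eauto using eqt_T.
  - apply (T_Sig Us w X' _ A' B' (el A') (fun x => el (subst1 x B')));
      eauto using eqt_T, eqt_sym.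
  - apply SigR_req; eauto using eqt_req.
    eapply good_el; eapply eqt_T; eauto using eqt_sub.
Qed.

Lemma eqt_Id (Us : nat -> fam -> Prop) (w : W) (A A' a a' b b' X X' : expr) :
  subU Us -> eval X (tId A a b) -> eval X' (tId A' a' b') ->
  eqt Us w A A' -> el A w a a' -> el A w b b' -> eqt Us w X X'.
Proof.
  intros HU E E' HA Ha Hb.
  assert (req w (el A) (el A')) as EA by eauto using eqt_req.
  apply (T_eqt _ _ _ _ (IdR (el A) a b) (IdR (el A') a' b')).
  - eapply T_Id; [exact E|eauto using eqt_T| | |apply req_refl];
      eauto using el_trans, el_sym.
  - eapply T_Id; [exact E'|eauto using eqt_T, eqt_sym| | |apply req_refl];
      apply (EA w (le_refl w)); eauto using el_trans, el_sym.
  - intros v Hv t t'; unfold IdR.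
    assert (el A v a a') by eauto using el_le.
    assert (el A v b b') by eauto using el_le.
    assert (el A v a b <-> el A' v a' b') as ->; [|tauto].
    rewrite <- (EA v Hv a' b'); split; intros; eauto using el_trans, el_sym.
Qed.

Lemma el_app (w : W) (A B A1 B1 A2 B2 f f' a a' : expr) :
  el (tPi A B) w f f' -> el A w a a' ->
  el (subst1 a B) w (tApp A1 B1 f a) (tApp A2 B2 f' a').
Proof.
  intros Hf Ha; apply (el_equiv _ _ (app f a) (app f' a'));
    try apply equiv_app, equiv_refl.
  apply (el_Pi w A B _ _ (ev_Pi _ _ _) (el_T _ _ _ _ Hf) w) in Hf; auto.
Qed.

Lemma el_lam (w : W) (A B f f' : expr) :
  eqt Uall w (tPi A B) (tPi A B) ->
  (forall v x x', le w v -> el A v x x' ->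
    el (subst1 x B) v (app f x) (app f' x')) ->
  el (tPi A B) w f f'.
Proof.
  intros (R & H & _) Hf.
  apply (el_Pi w A B _ _ (ev_Pi _ _ _) H w); auto.
Qed.

Lemma el_fst (w : W) (A B A1 B1 A2 B2 p p' : expr) :
  el (tSig A B) w p p' -> el A w (tFst A1 B1 p) (tFst A2 B2 p').
Proof.
  intros Hp; apply (el_equiv _ _ (fst' p) (fst' p'));
    try apply equiv_fst, equiv_refl.
  apply (el_Sig w A B _ _ (ev_Sig _ _ _) (el_T _ _ _ _ Hp) w) in Hp; auto.
  apply Hp.
Qed.

Lemma el_snd (w : W) (A B A1 B1 A2 B2 A3 B3 p p' : expr) :
  el (tSig A B) w p p' ->
  eqt Uall w (subst1 (fst' p) B) (subst1 (tFst A3 B3 p) B) ->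
  el (subst1 (tFst A3 B3 p) B) w (tSnd A1 B1 p) (tSnd A2 B2 p').
Proof.
  intros Hp HB; apply (el_equiv _ _ (snd' p) (snd' p'));
    try apply equiv_snd, equiv_refl.
  apply (el_Sig w A B _ _ (ev_Sig _ _ _) (el_T _ _ _ _ Hp) w) in Hp; auto.
  eapply el_eqt; [exact HB|apply Hp].
Qed.

Lemma el_pair (w : W) (A B p p' : expr) :
  eqt Uall w (tSig A B) (tSig A B) ->
  el A w (fst' p) (fst' p') -> el (subst1 (fst' p) B) w (snd' p) (snd' p') ->
  el (tSig A B) w p p'.
Proof.
  intros (R & H & _) H1 H2.
  apply (el_Sig w A B _ _ (ev_Sig _ _ _) H w); auto; split; assumption.
Qed.

(** * Semantic judgments and the rules valid for them *)

(** Types are instantiated by the left substitution only; [sctx] is what allows switching sides in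
    [env_sym]. *)
Fixpoint env (w : W) (G : ctx) (s s' : nat -> expr) : Prop :=
  match G with
  | [] => True
  | A :: D =>
      env w D (fun n => s (S n)) (fun n => s' (S n)) /\
      el (subst (fun n => s (S n)) A) w (s 0) (s' 0)
  end.

Fixpoint sctx (G : ctx) : Prop :=
  match G with
  | [] => True
  | A :: D => sctx D /\ forall w s s', env w D s s' ->
      eqt Uall w (subst s A) (subst s' A)
  end.

Definition sty (G : ctx) (A A' : expr) : Prop :=
  sctx G /\ forall w s s', env w G s s' -> eqt Uall w (subst s A) (subst s' A').

(** The component [sty G A A] keeps the presupposition at hand, in place of a syntactic validity
    lemma. *)
Definition stm (G : ctx) (t t' A : expr) : Prop :=
  sty G A A /\ forall w s s', env w G s s' ->
    el (subst s A) w (subst s t) (subst s' t').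

Lemma env_sym (G : ctx) : sctx G ->
  forall w s s', env w G s s' -> env w G s' s.
Proof.
  induction G as [|A G IH]; simpl; [auto|].
  intros [HG HA] w s s' [Hs Ha]; split; [auto|].
  eapply el_eqt; [apply HA, Hs|]; auto using el_sym.
Qed.

Lemma env_trans (G : ctx) : sctx G ->
  forall w s s' s'', env w G s s' -> env w G s' s'' -> env w G s s''.
Proof.
  induction G as [|A G IH]; simpl; [auto|].
  intros [HG HA] w s s' s'' [Hs Ha] [Hs' Ha']; split; [eauto|].
  eapply el_trans; [eassumption|].
  eapply el_eqt; [apply HA|exact Ha'].
  apply env_sym; auto.
Qed.

Lemma env_refl (G : ctx) : sctx G ->
  forall w s s', env w G s s' -> env w G s s.
Proof. eauto using env_trans, env_sym. Qed.

Lemma env_le (G : ctx) (w v : W) : le w v ->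
  forall s s', env w G s s' -> env v G s s'.
Proof.
  intros Hv; induction G as [|A G IH]; simpl; [auto|].
  intros s s' [Hs Ha]; eauto using el_le.
Qed.

Lemma env_cons (G : ctx) (A x x' : expr) (w : W) (s s' : nat -> expr) :
  env w G s s' -> el (subst s A) w x x' -> env w (A :: G) (scons x s) (scons x' s').
Proof. split; assumption. Qed.

Lemma sty_sym (G : ctx) (A A' : expr) : sty G A A' -> sty G A' A.
Proof.
  intros [HG H]; split; [assumption|]; intros w s s' Hs.
  apply eqt_sym, H, env_sym; assumption.
Qed.

Lemma sty_trans (G : ctx) (A A' A'' : expr) :
  sty G A A' -> sty G A' A'' -> sty G A A''.
Proof.
  intros [HG H] [_ H']; split; [assumption|]; intros w s s' Hs.
  (* The first step stays at [s]; only the second moves from [s] to [s']. *)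
  eapply eqt_trans; [auto|apply H; eapply env_refl; eassumption|auto].
Qed.

Lemma sty_refl (G : ctx) (A A' : expr) : sty G A A' -> sty G A A.
Proof. eauto using sty_trans, sty_sym. Qed.

Lemma stm_sym (G : ctx) (t t' A : expr) : stm G t t' A -> stm G t' t A.
Proof.
  intros [HA H]; split; [assumption|]; intros w s s' Hs.
  eapply el_eqt; [apply HA, env_sym; [apply HA|eassumption]|].
  apply el_sym, H, env_sym; [apply HA|assumption].
Qed.

Lemma stm_trans (G : ctx) (t t' t'' A : expr) :
  stm G t t' A -> stm G t' t'' A -> stm G t t'' A.
Proof.
  intros [HA H] [_ H']; split; [assumption|]; intros w s s' Hs.
  eapply el_trans; [apply H; eapply env_refl; [apply HA|]|]; eauto.
Qed.

Lemma stm_refl (G : ctx) (t t' A : expr) : stm G t t' A -> stm G t t A.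
Proof. eauto using stm_trans, stm_sym. Qed.

Lemma stm_conv (G : ctx) (t t' A A' : expr) :
  stm G t t' A -> sty G A A' -> stm G t t' A'.
Proof.
  intros [HA H] HA'; split; [eauto using sty_refl, sty_sym|]; intros w s s' Hs.
  eapply el_eqt; [|apply H, Hs].
  apply HA'; eapply env_refl; [apply HA|eassumption].
Qed.

Lemma stm_sctx (G : ctx) (t t' A : expr) : stm G t t' A -> sctx G.
Proof. intros [[H _] _]; exact H. Qed.

Lemma env_subst1 (G : ctx) (A a a' : expr) (w : W) (s s' : nat -> expr) :
  stm G a a' A -> env w G s s' ->
  env w (A :: G) (scons (subst s a) s) (scons (subst s' a') s').
Proof. intros [_ H] Hs; apply env_cons; auto. Qed.

Lemma sctx_cons (G : ctx) (A : expr) : sty G A A -> sctx (A :: G).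
Proof. auto. Qed.

Lemma sty_subst1 (G : ctx) (A B B' a a' : expr) :
  sty (A :: G) B B' -> stm G a a' A -> sty G (subst1 a B) (subst1 a' B').
Proof.
  intros [HG HB] Ha; split; [apply HG|]; intros w s s' Hs.
  rewrite !subst_subst1; apply HB; eapply env_subst1; eassumption.
Qed.

Lemma stm_subst1 (G : ctx) (A B t t' a a' : expr) :
  stm (A :: G) t t' B -> stm G a a' A ->
  stm G (subst1 a t) (subst1 a' t') (subst1 a B).
Proof.
  intros [HB Ht] Ha; split.
  - eapply sty_subst1; [eassumption|eauto using stm_refl].
  - intros w s s' Hs; rewrite !subst_subst1; apply Ht.
    eapply env_subst1; eassumption.
Qed.

(** Closure under expansion: a computation rule reduces to validity of its right-hand side. *)
Lemma stm_equiv (G : ctx) (t t' u A : expr) :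
  (forall s, equiv (subst s u) (subst s t)) -> stm G t t' A -> stm G u t' A.
Proof.
  intros E [HA H]; split; [assumption|]; intros w s s' Hs.
  apply (el_equiv w _ (subst s t) (subst s' t')); auto using equiv_refl.
Qed.

Lemma sty_Pi (G : ctx) (A A' B B' : expr) :
  sty G A A' -> sty (A :: G) B B' -> sty G (tPi A B) (tPi A' B').
Proof.
  intros [HG HA] [_ HB]; split; [assumption|]; intros w s s' Hs; simpl.
  eapply eqt_Pi; [auto|constructor..|auto|].
  intros v x x' Hv Hx; rewrite !subst1_up.
  apply HB, env_cons; eauto using env_le.
Qed.

Lemma sty_Sig (G : ctx) (A A' B B' : expr) :
  sty G A A' -> sty (A :: G) B B' -> sty G (tSig A B) (tSig A' B').
Proof.
  intros [HG HA] [_ HB]; split; [assumption|]; intros w s s' Hs; simpl.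
  eapply eqt_Sig; [auto|constructor..|auto|].
  intros v x x' Hv Hx; rewrite !subst1_up.
  apply HB, env_cons; eauto using env_le.
Qed.

Lemma sty_Id (G : ctx) (A A' a a' b b' : expr) :
  sty G A A' -> stm G a a' A -> stm G b b' A -> sty G (tId A a b) (tId A' a' b').
Proof.
  intros [HG HA] [_ Ha] [_ Hb]; split; [assumption|]; intros w s s' Hs; simpl.
  eapply eqt_Id; [auto|constructor..|auto|auto|auto].
Qed.

Lemma sty_closed (G : ctx) (A : expr) :
  sctx G -> (forall s, subst s A = A) -> (forall w, exists R, T Uall w A R) ->
  sty G A A.
Proof.
  intros HG E H; split; [assumption|]; intros w s s' _; rewrite !E.
  destruct (H w) as [R HR]; exists R; auto.
Qed.

Lemma sty_Empty (G : ctx) : sctx G -> sty G tEmpty tEmpty.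
Proof.
  intros; apply sty_closed; auto; eexists; apply T_Empty; auto; constructor.
Qed.

Lemma sty_Bool (G : ctx) : sctx G -> sty G tBool tBool.
Proof.
  intros; apply sty_closed; auto; eexists; apply T_Bool; auto; constructor.
Qed.

Lemma sty_Nat (G : ctx) : sctx G -> sty G tNat tNat.
Proof.
  intros; apply sty_closed; auto; eexists; apply T_Nat; auto; constructor.
Qed.

Lemma sty_U (G : ctx) (i : nat) : sctx G -> sty G (tU i) (tU i).
Proof.
  intros; apply sty_closed; auto; eexists; eapply T_U; [constructor| |auto].
  exists (S i); simpl; auto.
Qed.

Lemma stm_U (G : ctx) (i : nat) (a a' : expr) :
  stm G a a' (tU i) <->
  sctx G /\ forall w s s', env w G s s' -> eqt (Un i) w (subst s a) (subst s' a').
Proof.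
  split.
  - intros [[HG _] H]; split; [assumption|]; intros w s s' Hs.
    apply (el_U i (tU i) w (ev_U _ _) w); [auto|exact (H w s s' Hs)].
  - intros [HG H]; split; [auto using sty_U|]; intros w s s' Hs.
    apply (el_U i (tU i) w (ev_U _ _) w); auto.
Qed.

Lemma sty_El (G : ctx) (i : nat) (a a' : expr) :
  stm G a a' (tU i) -> sty G (tEl i a) (tEl i a').
Proof.
  rewrite stm_U; intros [HG H]; split; [assumption|]; intros w s s' Hs; simpl.
  apply (eqt_equiv _ _ (subst s a) (subst s' a')); auto using equiv_El.
  apply (eqt_sub (Un i)); auto.
Qed.

Lemma sty_equiv (G : ctx) (A B B' : expr) :
  (forall s, equiv (subst s A) (subst s B)) -> sty G B B' -> sty G A B'.
Proof.
  intros E [HG H]; split; [assumption|]; intros w s s' Hs.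
  eapply eqt_equiv; [apply E|apply equiv_refl|auto].
Qed.

Lemma sty_wk (G : ctx) (A A' B : expr) :
  sctx (B :: G) -> sty G A A' -> sty (B :: G) (wk A) (wk A').
Proof.
  intros HB [_ H]; split; [assumption|]; intros w s s' [Hs _].
  rewrite !subst_wk; auto.
Qed.

Lemma stm_Var (G : ctx) (n : nat) (A : expr) :
  lookup G n A -> sctx G -> stm G (tVar n) (tVar n) A.
Proof.
  induction 1 as [G A|G A B n _ IH]; intros HG; pose proof HG as [HG' HA].
  - split; [apply sty_wk; [exact HG|split; assumption]|].
    intros w s s' [_ Ha]; rewrite subst_wk; exact Ha.
  - destruct (IH HG') as [HT Ht].
    split; [apply sty_wk; assumption|].
    intros w s s' [Hs _]; rewrite subst_wk; exact (Ht w _ _ Hs).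
Qed.

Lemma stm_Lam (G : ctx) (A A' B B' t t' : expr) :
  sty G A A' -> sty (A :: G) B B' -> stm (A :: G) t t' B ->
  stm G (tLam A B t) (tLam A' B' t') (tPi A B).
Proof.
  intros HA HB [_ Ht].
  assert (sty G (tPi A B) (tPi A B)) as HP by eauto using sty_Pi, sty_refl.
  split; [assumption|]; intros w s s' Hs; simpl.
  apply el_lam; [apply HP; eapply env_refl; [apply HA|eassumption]|].
  intros v x x' Hv Hx.
  eapply el_equiv; [apply equiv_app_Lam..|]; rewrite !subst1_up.
  apply Ht, env_cons; eauto using env_le.
Qed.

Lemma stm_App (G : ctx) (A A' B B' f f' a a' : expr) :
  sty (A :: G) B B' -> stm G f f' (tPi A B) -> stm G a a' A ->
  stm G (tApp A B f a) (tApp A' B' f' a') (subst1 a B).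
Proof.
  intros HB [_ Hf] Ha; split; [eauto using sty_subst1, sty_refl, stm_refl|].
  intros w s s' Hs; rewrite subst_subst1, <- subst1_up.
  eapply el_app; [apply Hf, Hs|apply Ha, Hs].
Qed.

Lemma stm_beta (G : ctx) (A B t a : expr) :
  stm (A :: G) t t B -> stm G a a A ->
  stm G (tApp A B (tLam A B t) a) (subst1 a t) (subst1 a B).
Proof.
  intros Ht Ha; apply (stm_equiv G (subst1 a t)).
  - intros s; simpl; rewrite subst_subst1, <- subst1_up.
    apply equiv_app_Lam.
  - eauto using stm_subst1.
Qed.

(** Functions are compared by applying them, so one beta step on the right leaves two applications
    of [f]. *)
Lemma stm_eta (G : ctx) (A B f : expr) :
  stm G f f (tPi A B) ->
  stm G f (tLam A B (tApp (wk A) (ren (up_ren S) B) (wk f) (tVar 0))) (tPi A B).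
Proof.
  intros [HP Hf]; split; [assumption|]; intros w s s' Hs; simpl.
  apply el_lam; [apply HP; eapply env_refl; [apply HP|eassumption]|].
  intros v x x' Hv Hx.
  eapply el_equiv; [apply equiv_refl|apply equiv_app_Lam|].
  assert (subst1 x' (subst (up s') (wk f)) = subst s' f) as E
    by (rewrite subst1_up; apply subst_scons_wk).
  unfold subst1 in E; unfold subst1 at 2; simpl; rewrite E.
  eapply el_app; [|exact Hx].
  eapply el_le; [exact Hv|exact (Hf w s s' Hs)].
Qed.

Lemma stm_Pair (G : ctx) (A A' B B' a a' b b' : expr) :
  sty G A A' -> sty (A :: G) B B' -> stm G a a' A -> stm G b b' (subst1 a B) ->
  stm G (tPair A B a b) (tPair A' B' a' b') (tSig A B).
Proof.
  intros HA HB Ha [_ Hb].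
  assert (sty G (tSig A B) (tSig A B)) as HP by eauto using sty_Sig, sty_refl.
  split; [assumption|]; intros w s s' Hs; simpl.
  assert (env w G s s) as Hs0 by (eapply env_refl; [apply HA|eassumption]).
  assert (el (subst s A) w (fst' (subst s (tPair A B a b)))
    (fst' (subst s' (tPair A' B' a' b')))) as H1.
  { eapply el_equiv; [apply equiv_fst_Pair..|apply Ha, Hs]. }
  apply el_pair; [apply HP; assumption|exact H1|].
  eapply el_equiv; [apply equiv_snd_Pair..|].
  (* [b] is typed over [a], but [SigR] indexes by the first projection of the pair; the two indices
     are Kleene equal. *)
  eapply el_eqt; [|apply Hb, Hs].
  rewrite subst_subst1, subst1_up.
  apply (proj2 (sty_refl _ _ _ HB)), env_cons; [assumption|].
  eapply el_equiv; [apply equiv_refl|apply equiv_fst_Pair|].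
  apply (stm_refl _ _ _ _ Ha), Hs0.
Qed.

Lemma stm_Fst (G : ctx) (A A' B B' p p' : expr) :
  sty G A A' -> stm G p p' (tSig A B) -> stm G (tFst A B p) (tFst A' B' p') A.
Proof.
  intros HA [_ Hp]; split; [eauto using sty_refl|]; intros w s s' Hs.
  exact (el_fst _ _ _ _ _ _ _ _ _ (Hp w s s' Hs)).
Qed.

Lemma stm_Snd (G : ctx) (A A' B B' p p' : expr) :
  sty G A A' -> sty (A :: G) B B' -> stm G p p' (tSig A B) ->
  stm G (tSnd A B p) (tSnd A' B' p') (subst1 (tFst A B p) B).
Proof.
  intros HA HB Hp.
  assert (stm G (tFst A B p) (tFst A B p) A) as H1
    by (apply stm_Fst; eauto using stm_refl, sty_refl).
  split; [eauto using sty_subst1, sty_refl|]; intros w s s' Hs.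
  assert (env w G s s) as Hs0 by (eapply env_refl; [apply HA|eassumption]).
  rewrite subst_subst1, <- subst1_up.
  eapply el_snd; [exact (proj2 Hp w s s' Hs)|].
  rewrite !subst1_up; apply (proj2 (sty_refl _ _ _ HB)), env_cons; [assumption|].
  apply (el_equiv w _ (subst s (tFst A B p)) (subst s (tFst A B p)));
    [apply equiv_fst, equiv_refl|apply equiv_refl|apply H1, Hs0].
Qed.

Lemma stm_Fst_beta (G : ctx) (A B a b : expr) :
  stm G a a A -> stm G (tFst A B (tPair A B a b)) a A.
Proof.
  intros Ha; apply (stm_equiv G a); [|assumption].
  intros s; apply equiv_fst_Pair.
Qed.

Lemma stm_Snd_beta (G : ctx) (A B a b : expr) :
  stm G b b (subst1 a B) -> stm G (tSnd A B (tPair A B a b)) b (subst1 a B).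
Proof.
  intros Hb; apply (stm_equiv G b); [|assumption].
  intros s; apply equiv_snd_Pair.
Qed.

Lemma stm_Sig_eta (G : ctx) (A B p : expr) :
  sty G A A -> sty (A :: G) B B -> stm G p p (tSig A B) ->
  stm G p (tPair A B (tFst A B p) (tSnd A B p)) (tSig A B).
Proof.
  intros HA HB Hp; split; [apply Hp|]; intros w s s' Hs; simpl.
  assert (env w G s s) as Hs0 by (eapply env_refl; [apply HA|eassumption]).
  apply el_pair; [apply Hp, Hs0|..].
  - eapply el_equiv; [apply equiv_refl|apply equiv_fst_Pair|].
    exact (el_fst _ _ _ _ _ _ _ _ _ (proj2 Hp w s s' Hs)).
  - eapply el_equiv; [apply equiv_refl|apply equiv_snd_Pair|].
    eapply el_snd; [exact (proj2 Hp w s s' Hs)|].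
    rewrite !subst1_up; apply HB, env_cons; [assumption|].
    exact (el_fst _ _ _ _ _ _ _ _ _ (proj2 Hp w s s Hs0)).
Qed.

Lemma stm_Refl (G : ctx) (A A' a a' : expr) :
  sty G A A' -> stm G a a' A -> stm G (tRefl A a) (tRefl A' a') (tId A a a).
Proof.
  intros HA Ha.
  assert (sty G (tId A a a) (tId A a a)) as HI
    by eauto using sty_Id, sty_refl, stm_refl.
  split; [assumption|]; intros w s s' Hs; simpl.
  assert (env w G s s) as Hs0 by (eapply env_refl; [apply HA|eassumption]).
  destruct (proj2 HI w s s Hs0) as (R & HR & _).
  apply (el_Id w _ _ _ _ R (ev_Id _ _ _ _) HR w); auto.
  left; repeat split; try constructor.
  apply (stm_refl _ _ _ _ Ha), Hs0.
Qed.

Ltac by_step :=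
  intros; intros ?; split; intros H';
  [inversion H'; subst; repeat det; assumption|econstructor; eassumption].

Lemma equiv_J (A a C d b p : expr) : eval p vrefl -> equiv (tJ A a C d b p) d.
Proof. by_step. Qed.

Lemma equiv_If_B0 (C c0 c1 t : expr) : eval t tB0 -> equiv (tIf C c0 c1 t) c0.
Proof. by_step. Qed.

Lemma equiv_If_B1 (C c0 c1 t : expr) : eval t tB1 -> equiv (tIf C c0 c1 t) c1.
Proof. by_step. Qed.

Lemma equiv_Natrec_Zero (C z s n : expr) :
  eval n tZero -> equiv (tNatrec C z s n) z.
Proof. by_step. Qed.

Lemma equiv_Natrec_Succ (C z s n m : expr) :
  eval n (tSucc m) -> equiv (tNatrec C z s n) (subst2 m (tNatrec C z s m) s).
Proof. by_step. Qed.

Lemma sty_T (G : ctx) (A A' : expr) (w : W) (s s' : nat -> expr) :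
  sty G A A' -> env w G s s' -> T Uall w (subst s A) (el (subst s A)).
Proof. intros [_ H] Hs; eapply eqt_T; [|apply H, Hs]; auto. Qed.

(** An element of the empty type is an error at a potential world; [tAbort] passes it on, and there
    it inhabits [C] as well. *)
Lemma stm_Abort (G : ctx) (C C' t t' : expr) :
  sty (tEmpty :: G) C C' -> stm G t t' tEmpty ->
  stm G (tAbort C t) (tAbort C' t') (subst1 t C).
Proof.
  intros HC Ht.
  assert (sty G (subst1 t C) (subst1 t C)) as HT
    by eauto using sty_subst1, sty_refl, stm_refl.
  split; [assumption|]; intros w s s' Hs.
  pose proof (proj2 Ht w s s' Hs) as H.
  apply (el_Empty w w (le_refl w)) in H as (Hp & H1 & H2).
  eapply el_err; eauto using sty_T; constructor; assumption.
Qed.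

Lemma stm_B0 (G : ctx) : sctx G -> stm G tB0 tB0 tBool.
Proof.
  intros HG; split; [auto using sty_Bool|]; intros w s s' Hs; simpl.
  apply (el_Bool w w (le_refl w)); left; exists true; split; constructor.
Qed.

Lemma stm_B1 (G : ctx) : sctx G -> stm G tB1 tB1 tBool.
Proof.
  intros HG; split; [auto using sty_Bool|]; intros w s s' Hs; simpl.
  apply (el_Bool w w (le_refl w)); left; exists false; split; constructor.
Qed.

Lemma natR_el (w : W) (n n' : expr) : NatR w n n' <-> el tNat w n n'.
Proof. symmetry; apply (el_Nat w w (le_refl w)). Qed.

Lemma boolR_el (w : W) (b b' : expr) : BoolR w b b' <-> el tBool w b b'.
Proof. symmetry; apply (el_Bool w w (le_refl w)). Qed.

Lemma stm_If (G : ctx) (C C' c0 c0' c1 c1' t t' : expr) :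
  sty (tBool :: G) C C' ->
  stm G c0 c0' (subst1 tB0 C) -> stm G c1 c1' (subst1 tB1 C) ->
  stm G t t' tBool ->
  stm G (tIf C c0 c1 t) (tIf C' c0' c1' t') (subst1 t C).
Proof.
  intros HC H0 H1 Ht.
  assert (sty G (subst1 t C) (subst1 t C)) as HT
    by eauto using sty_subst1, sty_refl, stm_refl.
  split; [assumption|]; intros w s s' Hs.
  assert (env w G s s) as Hs0 by (eapply env_refl; [apply HT|eassumption]).
  pose proof (proj2 Ht w s s' Hs) as H; apply boolR_el in H.
  destruct H as [(b & E & E')|(Hp & E & E')].
  - assert (eqt Uall w (subst (scons (dbool b) s) C) (subst s (subst1 t C))) as HE.
    { rewrite subst_subst1; apply (proj2 (sty_refl _ _ _ HC)).
      apply env_cons; [assumption|]; apply boolR_el; left.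
      exists b; split; [destruct b; constructor|assumption]. }
    eapply el_eqt; [exact HE|]; destruct b; simpl.
    + eapply el_equiv; [apply equiv_If_B0, E|apply equiv_If_B0, E'|].
      rewrite <- (subst_subst1 s tB0); apply H0, Hs.
    + eapply el_equiv; [apply equiv_If_B1, E|apply equiv_If_B1, E'|].
      rewrite <- (subst_subst1 s tB1); apply H1, Hs.
  - eapply el_err; eauto using sty_T; now apply ev_If_err.
Qed.

Lemma stm_If_B0 (G : ctx) (C c0 c1 : expr) :
  stm G c0 c0 (subst1 tB0 C) -> stm G (tIf C c0 c1 tB0) c0 (subst1 tB0 C).
Proof.
  apply stm_equiv; intros s; apply equiv_If_B0; constructor.
Qed.

Lemma stm_If_B1 (G : ctx) (C c0 c1 : expr) :
  stm G c1 c1 (subst1 tB1 C) -> stm G (tIf C c0 c1 tB1) c1 (subst1 tB1 C).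
Proof.
  apply stm_equiv; intros s; apply equiv_If_B1; constructor.
Qed.

Lemma stm_Zero (G : ctx) : sctx G -> stm G tZero tZero tNat.
Proof.
  intros HG; split; [auto using sty_Nat|]; intros w s s' Hs; simpl.
  apply natR_el, NatR_Zero; constructor.
Qed.

Lemma stm_Succ (G : ctx) (n n' : expr) :
  stm G n n' tNat -> stm G (tSucc n) (tSucc n') tNat.
Proof.
  intros [HN Hn]; split; [assumption|]; intros w s s' Hs; simpl.
  apply natR_el; eapply NatR_Succ; [constructor..|].
  apply natR_el, (Hn w s s' Hs).
Qed.

(** Induction on [NatR] rather than on numbers, since an element may be some successors of an error.
    Each case first replaces the index of [C] by its value. *)
Lemma el_Natrec (G : ctx) (C C' z z' r r' : expr) (w : W) (s s' : nat -> expr) :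
  sty (tNat :: G) C C' -> stm G z z' (subst1 tZero C) ->
  stm (C :: tNat :: G) r r' (substS C) -> env w G s s' ->
  forall n n', NatR w n n' ->
  el (subst (scons n s) C) w
    (tNatrec (subst (up s) C) (subst s z) (subst (up (up s)) r) n)
    (tNatrec (subst (up s') C') (subst s' z') (subst (up (up s')) r') n').
Proof.
  intros HC [_ Hz] [_ Hr] Hs.
  assert (env w G s s) as Hs0 by (eapply env_refl; [apply HC|eassumption]).
  assert (forall m n, NatR w m n ->
    eqt Uall w (subst (scons m s) C) (subst (scons n s) C)) as HE.
  { intros m n Hn; apply (proj2 (sty_refl _ _ _ HC)), env_cons; [assumption|].
    now apply natR_el. }
  assert (forall n n', NatR w n n' -> NatR w n n) as Hrefl.
  { intros n n' Hn; eapply good_refl; eauto using good_NatR. }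
  induction 1 as [n n' E E'|n n' m m' E E' Hm IH|n n' (Hp & E & E')].
  - apply (el_eqt w (subst (scons tZero s) C)).
    { apply HE, NatR_Zero; [constructor|assumption]. }
    eapply el_equiv; [apply equiv_Natrec_Zero, E|apply equiv_Natrec_Zero, E'|].
    rewrite <- (subst_subst1 s tZero); apply Hz, Hs.
  - apply (el_eqt w (subst (scons (tSucc m) s) C)).
    { apply HE; eapply NatR_Succ; [constructor|eassumption|eauto]. }
    eapply el_equiv;
      [apply equiv_Natrec_Succ, E|apply equiv_Natrec_Succ, E'|].
    rewrite !subst2_up.
    match goal with |- el _ _ (subst (scons ?x _) _) _ =>
      rewrite <- (subst_substS s x m C) end.
    apply Hr, env_cons; [|exact IH].
    apply env_cons; [assumption|]; now apply natR_el.
  - assert (NatR w n n) as Hn by (apply NatR_err; repeat split; assumption).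
    destruct (HE n n Hn) as (R & HR & _).
    eapply el_err; eauto; now apply ev_Natrec_err.
Qed.

Lemma stm_Natrec (G : ctx) (C C' z z' r r' n n' : expr) :
  sty (tNat :: G) C C' -> stm G z z' (subst1 tZero C) ->
  stm (C :: tNat :: G) r r' (substS C) -> stm G n n' tNat ->
  stm G (tNatrec C z r n) (tNatrec C' z' r' n') (subst1 n C).
Proof.
  intros HC Hz Hr Hn.
  split; [eauto using sty_subst1, sty_refl, stm_refl|]; intros w s s' Hs.
  rewrite subst_subst1; eapply el_Natrec; eauto.
  apply natR_el, (proj2 Hn w s s' Hs).
Qed.

Lemma stm_Natrec_Zero (G : ctx) (C z r : expr) :
  stm G z z (subst1 tZero C) ->
  stm G (tNatrec C z r tZero) z (subst1 tZero C).
Proof.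
  apply stm_equiv; intros s; apply equiv_Natrec_Zero; constructor.
Qed.

Lemma stm_Natrec_Succ (G : ctx) (C z r n : expr) :
  sty (tNat :: G) C C -> stm G z z (subst1 tZero C) ->
  stm (C :: tNat :: G) r r (substS C) -> stm G n n tNat ->
  stm G (tNatrec C z r (tSucc n)) (subst2 n (tNatrec C z r n) r)
    (subst1 (tSucc n) C).
Proof.
  intros HC Hz Hr Hn; apply (stm_equiv G (subst2 n (tNatrec C z r n) r)).
  - intros s; rewrite subst_subst2, <- subst2_up.
    apply equiv_Natrec_Succ; constructor.
  - split; [eauto using sty_subst1, stm_Succ|]; intros w s s' Hs.
    rewrite !subst_subst2, subst_subst1.
    change (subst s (tSucc n)) with (tSucc (subst s n)).
    rewrite <- (subst_substS s (subst s (tNatrec C z r n)) (subst s n) C).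
    apply Hr, env_cons; [eapply env_subst1; eauto|].
    rewrite <- subst_subst1; now apply (stm_Natrec G C C z z r r n n).
Qed.

Lemma env_ctxJ (G : ctx) (A a b b' p p' : expr) (w : W) (s s' : nat -> expr) :
  env w G s s' -> el (subst s A) w b b' ->
  el (tId (subst s A) (subst s a) b) w p p' ->
  env w (ctxJ G A a) (scons p (scons b s)) (scons p' (scons b' s')).
Proof.
  intros Hs Hb Hp; apply env_cons; [apply env_cons; assumption|].
  simpl; rewrite !subst_scons_wk; assumption.
Qed.

Lemma stm_J (G : ctx) (A A' a a' C C' d d' b b' p p' : expr) :
  sty G A A' -> stm G a a' A -> sty (ctxJ G A a) C C' ->
  stm G d d' (subst2 a (tRefl A a) C) -> stm G b b' A -> stm G p p' (tId A a b) ->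
  stm G (tJ A a C d b p) (tJ A' a' C' d' b' p') (subst2 b p C).
Proof.
  intros HA Ha HC Hd Hb Hp.
  assert (sty G (subst2 b p C) (subst2 b p C)) as HT.
  { split; [apply HA|]; intros w s s' Hs; rewrite !subst_subst2.
    apply (proj2 (sty_refl _ _ _ HC)), env_ctxJ; [assumption|..].
    - apply (stm_refl _ _ _ _ Hb), Hs.
    - apply (stm_refl _ _ _ _ Hp), Hs. }
  split; [assumption|]; intros w s s' Hs.
  assert (env w G s s) as Hs0 by (eapply env_refl; [apply HA|eassumption]).
  pose proof (proj2 Hp w s s' Hs) as H; simpl in H.
  pose proof (el_T _ _ _ _ H) as HI.
  assert (req w (el (tId (subst s A) (subst s a) (subst s b)))
    (IdR (el (subst s A)) (subst s a) (subst s b))) as EI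
    by (apply (el_Id w _ _ _ _ _ (ev_Id _ _ _ _) HI)).
  apply (EI w (le_refl w)) in H as [(E & E' & Hab)|(H & E & E')].
  - eapply el_equiv; [apply equiv_J, E|apply equiv_J, E'|].
    (* [p] evaluates to reflexivity and [Hab] equates the end points, so the motive takes equal
       values at [a] with reflexivity and at [b] with [p]. *)
    eapply el_eqt; [|apply Hd, Hs].
    rewrite !subst_subst2.
    apply (proj2 (sty_refl _ _ _ HC)), env_ctxJ; [assumption..|].
    assert (stm G (tRefl A a) (tRefl A a) (tId A a a)) as Hr
      by (apply stm_Refl; eauto using sty_refl, stm_refl).
    pose proof (proj2 Hr w s s Hs0) as Hr'.
    pose proof (el_T _ _ _ _ Hr') as HI'.
    apply (el_Id w _ _ _ _ _ (ev_Id _ _ _ _) HI' w (le_refl w)).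
    left; repeat split; [constructor|assumption|].
    apply (stm_refl _ _ _ _ Ha), Hs0.
  - eapply el_err; eauto using sty_T; now apply ev_J_err.
Qed.

Lemma stm_J_beta (G : ctx) (A a C d : expr) :
  stm G d d (subst2 a (tRefl A a) C) ->
  stm G (tJ A a C d a (tRefl A a)) d (subst2 a (tRefl A a) C).
Proof. apply stm_equiv; intros s; apply equiv_J; constructor. Qed.

Lemma el_El (i : nat) (a t t' : expr) (w : W) :
  el (tEl i a) w t t' <-> el a w t t'.
Proof.
  split; intros (R & H & Ht); exists R; (split; [|assumption]);
    eapply T_equiv; eauto using equiv_El, equiv_sym.
Qed.

(* The binder of a code is typed in the decoded context, whereas [eqt_Pi] and
   [eqt_Sig] quantify over the elements of the code itself. *)
Lemma env_code (G : ctx) (i : nat) (a x x' : expr) (w v : W) (s s' : nat -> expr) :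
  env w G s s' -> le w v -> el (subst s a) v x x' ->
  env v (tEl i a :: G) (scons x s) (scons x' s').
Proof.
  intros Hs Hv Hx; apply env_cons; [eauto using env_le|].
  now apply el_El.
Qed.

(** Since [tLift] is erased, this inclusion of stages is the whole meaning of the coercion. *)
Lemma eqt_Un_S (i : nat) (w : W) (A B : expr) :
  eqt (Un i) w A B -> eqt (Un (S i)) w A B.
Proof.
  intros (R & H & H'); exists R; split; apply (T_sub (Un i)); simpl; auto.
Qed.

(** * Codes, decoding and coercions *)

Section Codes.

Variables (G : ctx) (i : nat) (a a' : expr).
Hypothesis Ha : stm G a a' (tU i).

Section Families.

Variables b b' : expr.
Hypothesis Hb : stm (tEl i a :: G) b b' (tU i).

Lemma eqt_code_family (w v : W) (s s' : nat -> expr) (x x' : expr) :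
  env w G s s' -> le w v -> el (subst s a) v x x' ->
  eqt (Un i) v (subst1 x (subst (up s) b)) (subst1 x' (subst (up s') b')).
Proof.
  intros Hs Hv Hx; rewrite !subst1_up.
  apply stm_U in Hb; apply Hb; eapply env_code; eassumption.
Qed.

Lemma eqt_code (w : W) (s s' : nat -> expr) :
  env w G s s' -> eqt (Un i) w (subst s a) (subst s' a').
Proof. apply stm_U in Ha; apply Ha. Qed.

Lemma stm_cPi : stm G (cPi i a b) (cPi i a' b') (tU i).
Proof.
  apply stm_U; split; [eapply stm_sctx, Ha|]; intros w s s' Hs; cbn [subst].
  eapply eqt_Pi; [auto|constructor..|auto using eqt_code|].
  eauto using eqt_code_family.
Qed.

Lemma stm_cSig : stm G (cSig i a b) (cSig i a' b') (tU i).
Proof.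
  apply stm_U; split; [eapply stm_sctx, Ha|]; intros w s s' Hs; cbn [subst].
  eapply eqt_Sig; [auto|constructor..|auto using eqt_code|].
  eauto using eqt_code_family.
Qed.

Lemma sty_El_Pi : sty G (tEl i (cPi i a b)) (tPi (tEl i a') (tEl i b')).
Proof.
  split; [eapply stm_sctx, Ha|]; intros w s s' Hs; cbn [subst].
  eapply eqt_Pi; [auto|repeat constructor..| |].
  - apply (eqt_equiv _ _ (subst s a) (subst s' a')); auto using equiv_refl, equiv_El.
    apply (eqt_sub (Un i)); auto using eqt_code.
  - intros v x x' Hv Hx; eapply eqt_equiv; [apply equiv_refl|apply equiv_El|].
    apply (eqt_sub (Un i)); eauto using eqt_code_family.
Qed.

Lemma sty_El_Sig : sty G (tEl i (cSig i a b)) (tSig (tEl i a') (tEl i b')).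
Proof.
  split; [eapply stm_sctx, Ha|]; intros w s s' Hs; cbn [subst].
  eapply eqt_Sig; [auto|repeat constructor..| |].
  - apply (eqt_equiv _ _ (subst s a) (subst s' a')); auto using equiv_refl, equiv_El.
    apply (eqt_sub (Un i)); auto using eqt_code.
  - intros v x x' Hv Hx; eapply eqt_equiv; [apply equiv_refl|apply equiv_El|].
    apply (eqt_sub (Un i)); eauto using eqt_code_family.
Qed.

(** Both sides evaluate to products whose parts differ by [tLift], which evaluation erases; strict
    commutation is then an instance of [eqt_Pi]. *)
Lemma stm_Lift_Pi :
  stm G (tLift i (cPi i a b)) (cPi (S i) (tLift i a') (tLift i b')) (tU (S i)).
Proof.
  apply stm_U; split; [eapply stm_sctx, Ha|]; intros w s s' Hs; cbn [subst].
  eapply eqt_Pi; [auto|repeat constructor..| |].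
  - apply (eqt_equiv _ _ (subst s a) (subst s' a'));
      auto using equiv_refl, equiv_Lift, eqt_Un_S, eqt_code.
  - intros v x x' Hv Hx; eapply eqt_equiv; [apply equiv_refl|apply equiv_Lift|].
    eauto using eqt_Un_S, eqt_code_family.
Qed.

Lemma stm_Lift_Sig :
  stm G (tLift i (cSig i a b)) (cSig (S i) (tLift i a') (tLift i b')) (tU (S i)).
Proof.
  apply stm_U; split; [eapply stm_sctx, Ha|]; intros w s s' Hs; cbn [subst].
  eapply eqt_Sig; [auto|repeat constructor..| |].
  - apply (eqt_equiv _ _ (subst s a) (subst s' a'));
      auto using equiv_refl, equiv_Lift, eqt_Un_S, eqt_code.
  - intros v x x' Hv Hx; eapply eqt_equiv; [apply equiv_refl|apply equiv_Lift|].
    eauto using eqt_Un_S, eqt_code_family.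
Qed.

End Families.

Lemma stm_Lift : stm G (tLift i a) (tLift i a') (tU (S i)).
Proof.
  apply stm_U; split; [eapply stm_sctx, Ha|]; intros w s s' Hs; cbn [subst].
  apply (eqt_equiv _ _ (subst s a) (subst s' a')); auto using equiv_Lift.
  apply eqt_Un_S, eqt_code, Hs.
Qed.

Variables t t' u u' : expr.
Hypothesis Ht : stm G t t' (tEl i a).
Hypothesis Hu : stm G u u' (tEl i a).

Lemma stm_cId : stm G (cId i a t u) (cId i a' t' u') (tU i).
Proof.
  apply stm_U; split; [eapply stm_sctx, Ha|]; intros w s s' Hs; cbn [subst].
  eapply eqt_Id; [auto|constructor..|auto using eqt_code| |];
    apply (el_El i); [apply Ht, Hs|apply Hu, Hs].
Qed.

Lemma sty_El_Id : sty G (tEl i (cId i a t u)) (tId (tEl i a') t' u').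
Proof.
  split; [eapply stm_sctx, Ha|]; intros w s s' Hs; cbn [subst].
  eapply eqt_Id; [auto|repeat constructor..| | |].
  - apply (eqt_equiv _ _ (subst s a) (subst s' a')); auto using equiv_refl, equiv_El.
    apply (eqt_sub (Un i)); auto using eqt_code.
  - apply (el_El i); apply Ht, Hs.
  - apply (el_El i); apply Hu, Hs.
Qed.

Lemma stm_Lift_Id :
  stm G (tLift i (cId i a t u)) (cId (S i) (tLift i a') t' u') (tU (S i)).
Proof.
  apply stm_U; split; [eapply stm_sctx, Ha|]; intros w s s' Hs; cbn [subst].
  eapply eqt_Id; [auto|repeat constructor..| | |].
  - apply (eqt_equiv _ _ (subst s a) (subst s' a'));
      auto using equiv_refl, equiv_Lift, eqt_Un_S, eqt_code.
  - apply (el_El i); apply Ht, Hs.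
  - apply (el_El i); apply Hu, Hs.
Qed.

End Codes.

Lemma T_base (Us : nat -> fam -> Prop) (A : expr) :
  eval A tEmpty \/ eval A tBool \/ eval A tNat -> exists R, forall w, T Us w A R.
Proof.
  intros [H|[H|H]]; eexists; intros w;
    [apply T_Empty|apply T_Bool|apply T_Nat]; auto using req_refl.
Qed.

Lemma stm_code_base (G : ctx) (i : nat) (a a' v : expr) :
  sctx G -> (forall s, subst s a = a) -> (forall s, subst s a' = a') ->
  eval a v -> eval a' v -> (v = tEmpty \/ v = tBool \/ v = tNat) ->
  stm G a a' (tU i).
Proof.
  intros HG E E' Ha Ha' Hv; apply stm_U; split; [assumption|]; intros w s s' _.
  rewrite E, E'.
  apply (eqt_equiv _ _ v v);
    try (apply equiv_eval; [assumption|intuition (subst; constructor)]).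
  destruct (T_base (Un i) v) as (R & HR);
    [intuition (subst; auto using ev_Empty, ev_Bool, ev_Nat)|].
  exists R; auto.
Qed.

Lemma stm_cU (G : ctx) (i : nat) : sctx G -> stm G (cU i) (cU i) (tU (S i)).
Proof.
  intros HG; apply stm_U; split; [assumption|]; intros w s s' _; simpl.
  (* Universe [i] is the topmost one offered at stage [S i]. *)
  exists (eqt (Un i)); split; eapply T_U; simpl; auto; constructor.
Qed.

(** The cases left over are the empty context, the constant codes and the erased coercion; apart
    from the first, they are settled by comparing values. *)
Theorem soundness :
  (forall G, wf_ctx G -> sctx G) /\
  (forall G A, is_type G A -> sty G A A) /\
  (forall G A A', eq_type G A A' -> sty G A A') /\
  (forall G t A, has_type G t A -> stm G t t A) /\
  (forall G t t' A, eq_term G t t' A -> stm G t t' A).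
Proof.
  apply judgments_mut; intros;
    eauto 2 using sty_Pi, sty_Sig, sty_Id, sty_Empty, sty_Bool, sty_Nat, sty_U, sty_El, sty_sym, sty_trans, sty_El_Pi, sty_El_Sig,
    sty_El_Id, stm_Var, stm_conv, stm_Lam, stm_App, stm_Pair, stm_Fst, stm_Snd,
    stm_Refl, stm_J, stm_Abort, stm_B0, stm_B1, stm_If, stm_Zero, stm_Succ,
    stm_Natrec, stm_cPi, stm_cSig, stm_cId, stm_cU, stm_Lift, stm_sym,
    stm_trans, stm_beta, stm_eta, stm_Fst_beta, stm_Snd_beta, stm_Sig_eta,
    stm_J_beta, stm_If_B0, stm_If_B1, stm_Natrec_Zero, stm_Natrec_Succ,
    stm_Lift_Pi, stm_Lift_Sig, stm_Lift_Id.
  - exact I.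
  - apply (sty_equiv _ _ tEmpty); [|auto using sty_Empty].
    intros s; apply equiv_eval; repeat constructor.
  - apply (sty_equiv _ _ tBool); [|auto using sty_Bool].
    intros s; apply equiv_eval; repeat constructor.
  - apply (sty_equiv _ _ tNat); [|auto using sty_Nat].
    intros s; apply equiv_eval; repeat constructor.
  - apply (sty_equiv _ _ (tU i)); [|auto using sty_U].
    intros s; apply equiv_eval; repeat constructor.
  - apply (sty_equiv _ _ (tEl i a)); [|auto using sty_El].
    intros s; simpl; eapply equiv_trans; [apply equiv_El|].
    eapply equiv_trans; [apply equiv_Lift|apply equiv_sym, equiv_El].
  - apply (stm_code_base _ _ _ _ tEmpty); auto; constructor.
  - apply (stm_code_base _ _ _ _ tBool); auto; constructor.
  - apply (stm_code_base _ _ _ _ tNat); auto; constructor.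
  - apply (stm_code_base _ _ _ _ tEmpty); auto; repeat constructor.
  - apply (stm_code_base _ _ _ _ tBool); auto; repeat constructor.
  - apply (stm_code_base _ _ _ _ tNat); auto; repeat constructor.
Qed.

Lemma soundness_closed (t A : expr) (w : W) : has_type [] t A -> el A w t t.
Proof.
  intros H; apply soundness in H as [_ H].
  specialize (H w tVar tVar I); now rewrite !subst_tVar in H.
Qed.

(** * Markov's principle in the model *)

Notation Fun := (tArr tNat tBool).
Notation Z := (has_zero (tVar 0)).

Lemma sctx_Fun : sctx [Fun].
Proof.
  assert (sctx [tNat]) by (apply sctx_cons, sty_Nat; exact I).
  apply sctx_cons, sty_Pi; [apply sty_Nat; exact I|apply sty_Bool; assumption].
Qed.

Lemma sty_Z : sty [Fun] Z Z.
Proof.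
  pose proof sctx_Fun as H.
  assert (sctx [tNat; Fun]) as H' by (apply sctx_cons, sty_Nat; exact H).
  apply sty_Sig; [apply sty_Nat; exact H|apply sty_Id].
  - apply sty_Bool; exact H'.
  - apply (stm_App [tNat; Fun] tNat tNat tBool tBool).
    + apply sty_Bool, sctx_cons, sty_Nat; exact H'.
    + apply (stm_Var _ 1 Fun); [|exact H'].
      exact (lookup_there _ _ tNat _ (lookup_here [] Fun)).
    + apply (stm_Var _ 0 tNat); [exact (lookup_here [Fun] tNat)|exact H'].
  - apply stm_B0; exact H'.
Qed.

Lemma sty_Not (G : ctx) (A : expr) : sty G A A -> sty G (tNot A) (tNot A).
Proof.
  intros HA; apply sty_Pi; [assumption|].
  apply sty_Empty, sctx_cons, HA.
Qed.

Lemma sty_subst (A p p' : expr) (w : W) :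
  sty [Fun] A A -> el Fun w p p' ->
  eqt Uall w (subst1 p A) (subst1 p' A).
Proof.
  intros HA Hp; apply (proj2 HA w), env_cons; [exact I|].
  now rewrite subst_tVar.
Qed.

Lemma el_refl (w : W) (A t t' : expr) : el A w t t' -> el A w t t.
Proof. eauto using el_trans, el_sym. Qed.

Lemma subst1_wk (a e : expr) : subst1 a (wk e) = e.
Proof. unfold subst1; rewrite subst_scons_wk; apply subst_tVar. Qed.

Lemma subst1_arr (p A B : expr) :
  subst1 p (tArr A B) = tArr (subst1 p A) (subst1 p B).
Proof.
  unfold tArr, subst1; simpl; f_equal; unfold wk.
  rewrite subst_ren, ren_subst; reflexivity.
Qed.

Lemma el_arr_app (w : W) (A B f f' a a' : expr) :
  el (tArr A B) w f f' -> el A w a a' -> el B w (app f a) (app f' a').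
Proof.
  intros Hf Ha; rewrite <- (subst1_wk a B); eapply el_app; eassumption.
Qed.

Lemma el_arr_lam (w : W) (A B f f' : expr) :
  eqt Uall w (tArr A B) (tArr A B) ->
  (forall v x x', le w v -> el A v x x' -> el B v (app f x) (app f' x')) ->
  el (tArr A B) w f f'.
Proof.
  intros HT H; apply el_lam; [assumption|].
  intros v x x' Hv Hx; rewrite subst1_wk; auto.
Qed.

Lemma el_MP_app (w : W) (t p h : expr) :
  el MP w t t -> el Fun w p p -> el (subst1 p (tNot (tNot Z))) w h h ->
  el (subst1 p Z) w (app (app t p) h) (app (app t p) h).
Proof.
  intros Ht Hp Hh.
  apply (el_arr_app w (subst1 p (tNot (tNot Z)))); [|assumption].
  rewrite <- subst1_arr; apply (el_app _ _ _ _ _ _ _ _ _ _ _ Ht Hp).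
Qed.

Lemma subst1_Z (p : expr) :
  exists B, subst1 p Z = tSig tNat B /\
    forall x, subst1 x B = tId tBool (tApp tNat tBool p x) tB0.
Proof.
  eexists; split; [reflexivity|]; intros x; simpl.
  pose proof (subst1_wk x p) as E; unfold subst1 in *; simpl; now rewrite E.
Qed.

(** Correctness of the witness rests on the identity proof, which may be an error at a potential
    world; that the first component is in [tNat] holds everywhere. *)
Lemma el_Z_elim (w : W) (p q q' : expr) :
  el (subst1 p Z) w q q' -> el tNat w (fst' q) (fst' q') /\
  (~ pot w -> eval (app p (fst' q)) tB0).
Proof.
  destruct (subst1_Z p) as (B & -> & EB); intros H.
  apply (el_Sig w _ _ _ _ (ev_Sig _ _ _) (el_T _ _ _ _ H) w) in H as [H1 H2]; auto.
  split; [assumption|]; intros Hw; rewrite EB in H2.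
  apply (el_Id w _ _ _ _ _ (ev_Id _ _ _ _) (el_T _ _ _ _ H2) w) in H2; auto.
  destruct H2 as [(_ & _ & H2)|[]]; [|contradiction].
  apply boolR_el in H2 as [(b & E & E')|[]]; [|contradiction].
  destruct b; [|inversion E'].
  exact (proj1 (equiv_app tNat tBool tEmpty tEmpty p p _ (equiv_refl p) _) E).
Qed.

Lemma NatR_num (w : W) (n : nat) : NatR w (num n) (num n).
Proof.
  induction n; [apply NatR_Zero|eapply NatR_Succ]; eauto; constructor.
Qed.

Lemma el_Z_intro (w : W) (p : expr) (k : nat) :
  el Fun w p p -> eval (app p (num k)) tB0 ->
  el (subst1 p Z) w (pair (num k) vrefl) (pair (num k) vrefl).
Proof.
  intros Hp E.
  assert (eqt Uall w (subst1 p Z) (subst1 p Z)) as HT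
    by (apply sty_subst; auto using sty_Z).
  destruct (subst1_Z p) as (B & EZ & EB); rewrite EZ in *.
  pose proof (fun x => equiv_fst_Pair tEmpty tEmpty tEmpty tEmpty (num k) x) as Ef.
  assert (el tNat w (fst' (pair (num k) vrefl)) (fst' (pair (num k) vrefl))) as Hk.
  { eapply el_equiv; [apply Ef..|]; apply natR_el, NatR_num. }
  apply el_pair; [assumption..|].
  rewrite EB.
  assert (el tBool w (tApp tNat tBool p (fst' (pair (num k) vrefl))) tB0) as Hb.
  { apply (el_trans w _ _ (app p (num k))).
    - eapply el_equiv; [apply equiv_app, equiv_refl|apply equiv_refl|].
      apply (el_arr_app w tNat tBool); [exact Hp|].
      eapply el_equiv; [apply Ef|apply equiv_refl|]; apply natR_el, NatR_num.
    - apply boolR_el; left; exists true; split; [assumption|constructor]. }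
  assert (eqt Uall w (tId tBool (tApp tNat tBool p (fst' (pair (num k) vrefl))) tB0)
    (tId tBool (tApp tNat tBool p (fst' (pair (num k) vrefl))) tB0)) as (R & HR & _).
  { eapply eqt_Id; [apply subU_Uall|constructor..| | |].
    - exists BoolR; split; apply T_Bool; auto; constructor.
    - eapply el_refl; eassumption.
    - eapply el_refl, el_sym; eassumption. }
  apply (el_Id w _ _ _ _ R (ev_Id _ _ _ _) HR w); auto.
  left; repeat split; try assumption;
    apply equiv_snd_Pair; constructor.
Qed.

(* At an actual world a refutation of [has_zero p] would turn a zero of [p]
   into an element of the empty type, so [err] vacuously realizes its negation. *)
Lemma el_not_not_Z (w : W) (p z : expr) :
  el Fun w p p -> el (subst1 p Z) w z z -> el (subst1 p (tNot (tNot Z))) w err err.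
Proof.
  intros Hp Hz.
  assert (eqt Uall w (subst1 p (tNot (tNot Z))) (subst1 p (tNot (tNot Z)))) as HT
    by (apply sty_subst; auto using sty_Not, sty_Z).
  unfold tNot in *; rewrite !subst1_arr in *.
  apply el_arr_lam; [assumption|]; intros v g g' Hv Hg.
  apply (el_arr_app v _ _ _ _ z z) in Hg; [|eauto using el_le].
  apply (el_Empty v v) in Hg as (Hp' & _); auto.
  apply (el_Empty v v); auto; repeat split; auto; apply ev_App_err; constructor.
Qed.

(** Each successor consumed shifts the oracle, so the induction has to be uniform in [k]; an error
    below the successors surfaces as the answer. *)
Lemma NatR_orc (w : W) (n n' : expr) (k : nat) :
  NatR w n n' -> BoolR w (app (orc k) n) (app (orc k) n').
Proof.
  intros H; revert k.
  induction H as [n n' E E'|n n' m m' E E' _ IH|n n' (Hp & E & E')];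
    intros k.
  - left; exists (o k); split; (eapply ev_App_orc_Zero; [constructor|assumption]).
  - destruct (IH (S k)) as [(b & H1 & H2)|(Hp & H1 & H2)].
    + left; exists b; split; (eapply ev_App_orc_Succ; [constructor|eassumption..]).
    + right; repeat split; auto;
        (eapply ev_App_orc_Succ; [constructor|eassumption..]).
  - right; repeat split; auto; (eapply ev_App_orc_err; [constructor|assumption]).
Qed.

Lemma el_orc (w : W) (k : nat) : el Fun w (orc k) (orc k).
Proof.
  apply el_arr_lam.
  - pose proof sctx_Fun as [_ H]; specialize (H w tVar tVar I).
    now rewrite subst_tVar in H.
  - intros v x x' Hv Hx; apply boolR_el, NatR_orc, natR_el, Hx.
Qed.

Lemma NatR_reads (w : W) (t t' : expr) :
  NatR w t t' -> exists n b, reads o t n b.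
Proof.
  induction 1 as [t t' E E'|t t' u u' E E' _ (n & b & IH)|t t' (_ & E & _)].
  - exists 0, true; now apply reads_Zero.
  - exists (S n), b; eapply reads_Succ; eassumption.
  - exists 0, false; now apply reads_err.
Qed.

(** Without errors a reading is a genuine numeral, and [reads] is functional by determinism. *)
Lemma NatR_actual (w : W) (t t' : expr) (n : nat) (b : bool) :
  NatR w t t' -> ~ pot w -> reads o t n b -> b = true /\ NatR w t (num n).
Proof.
  intros H Hw; revert n b.
  induction H as [t t' E E'|t t' u u' E E' _ IH|t t' (Hp & E & _)];
    intros n b; [| |contradiction];
    intros Hr; inversion Hr; subst; try det.
  - split; [reflexivity|]; apply NatR_Zero; [assumption|constructor].
  - match goal with H : reads _ _ _ _ |- _ => destruct (IH _ _ H) end.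
    split; [assumption|]; eapply NatR_Succ; [eassumption|constructor|assumption].
Qed.

(** [err] realizes the double negation here even if the oracle has no zero, so [t] is obliged to
    answer; nothing is claimed about the answer. *)
Lemma MP_potential (w : W) (t : expr) :
  pot w -> el MP w t t -> exists n b, reads o (fst' (app (app t (orc 0)) err)) n b.
Proof.
  intros Hw Ht.
  assert (el (subst1 (orc 0) (tNot (tNot Z))) w err err) as Hh.
  { assert (eqt Uall w (subst1 (orc 0) (tNot (tNot Z)))
      (subst1 (orc 0) (tNot (tNot Z)))) as (R & HR & _)
      by (apply sty_subst; auto using sty_Not, sty_Z, el_orc).
    eapply el_err; eauto; constructor. }
  pose proof (el_MP_app _ _ _ _ Ht (el_orc w 0) Hh) as H.
  apply el_Z_elim in H as [H _]; apply natR_el in H.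
  eapply NatR_reads; exact H.
Qed.

(** The zero [k] only serves to make [err] a realizer of the double negation. The program is that of
    [MP_potential], and now its answer must be correct. *)
Lemma MP_actual (w : W) (t : expr) (k n : nat) (b : bool) :
  ~ pot w -> el MP w t t -> o k = true ->
  reads o (fst' (app (app t (orc 0)) err)) n b -> o n = true.
Proof.
  intros Hw Ht Hk Hn.
  assert (eval (app (orc 0) (num k)) tB0) as Ek.
  { change tB0 with (dbool true); rewrite <- Hk; apply (reads_orc o _ k 0).
    clear; induction k; [apply reads_Zero|eapply reads_Succ]; eauto; constructor. }
  pose proof (el_not_not_Z _ _ _ (el_orc w 0)
    (el_Z_intro _ _ _ (el_orc w 0) Ek)) as Hh.
  pose proof (el_MP_app _ _ _ _ Ht (el_orc w 0) Hh) as H.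
  apply el_Z_elim in H as [H1 H2]; apply natR_el in H1.
  destruct (NatR_actual _ _ _ _ _ H1 Hw Hn) as [-> _].
  apply (reads_orc o _ n 0) in Hn.
  pose proof (eval_det _ _ _ _ Hn (H2 Hw)) as E; simpl in E.
  now destruct (o n).
Qed.

Lemma subst_num (s : nat -> expr) (n : nat) : subst s (num n) = num n.
Proof. induction n; simpl; congruence. Qed.

(** In the absence of errors a double negation is classically true existence, and unbounded search
    finds the number. *)
Lemma el_MP_srch (w : W) : (forall v, ~ pot v) -> el MP w srch srch.
Proof.
  intros Hw.
  assert (sctx [Fun]) as HF by apply sctx_Fun.
  assert (sty [Fun] (tArr (tNot (tNot Z)) Z) (tArr (tNot (tNot Z)) Z)) as HB.
  { apply sty_Pi; [auto using sty_Not, sty_Z|].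
    apply sty_wk; [|apply sty_Z]; apply sctx_cons; auto using sty_Not, sty_Z. }
  apply el_lam.
  { assert (sty [] MP MP) as H
      by (apply sty_Pi; [split; apply HF|exact HB]).
    specialize (proj2 H w tVar tVar I) as H'; now rewrite subst_tVar in H'. }
  intros v p p' Hv Hp.
  assert (el Fun v p p) as Hpp by eauto using el_refl.
  (* Functions are total on numerals and [p], [p'] agree there, so the search runs alike on both. *)
  assert (forall k, exists b,
    eval (app p (num k)) (dbool b) /\ eval (app p' (num k)) (dbool b)) as Hdec.
  { intros k.
    pose proof (el_arr_app v _ _ _ _ (num k) (num k) Hp) as H.
    apply boolR_el in H as [H|[H _]]; [assumption|now apply Hw in H|].
    apply natR_el, NatR_num. }
  rewrite subst1_arr; apply el_arr_lam.
  { rewrite <- subst1_arr; now apply sty_subst. }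
  intros u h h' Hu Hh.
  assert (exists k, eval (app p (num k)) tB0) as [k0 Hk0].
  (* If [p] had no zero, [err] would vacuously refute [has_zero], and [h] would send it to an
     element of the empty type. *)
  { apply NNPP; intros Hno.
    assert (el (subst1 p (tNot Z)) u err err) as Hn.
    { assert (eqt Uall u (subst1 p (tNot Z)) (subst1 p (tNot Z))) as HT
        by (apply sty_subst; eauto using sty_Not, sty_Z, el_le).
      unfold tNot in *; rewrite subst1_arr in *.
      apply el_arr_lam; [assumption|]; intros x z z' Hx Hz; exfalso.
      apply el_Z_elim in Hz as [Hz1 Hz2]; specialize (Hz2 (Hw _)).
      apply natR_el in Hz1; destruct (NatR_reads _ _ _ Hz1) as (n & b & Hn).
      apply (NatR_actual _ _ _ _ _ Hz1 (Hw _)), proj2, natR_el in Hn.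
      apply (el_arr_app x tNat tBool p p) in Hn; [|eauto using el_le].
      apply boolR_el in Hn as [(c & E1 & E2)|[H _]]; [|now apply Hw in H].
      apply Hno; exists n; pose proof (eval_det _ _ _ _ Hz2 E1) as E.
      now rewrite <- E in E2. }
    unfold tNot in Hh, Hn; rewrite !subst1_arr in Hh; rewrite subst1_arr in Hn.
    apply (el_arr_app u _ _ _ _ _ _ Hh) in Hn.
    apply (el_Empty u u) in Hn as [H _]; auto; now apply Hw in H. }
  (* The search rule asks for [tB1] below its result, so the least zero is taken. *)
  assert (exists k, eval (app p (num k)) tB0 /\
    forall m, m < k -> eval (app p (num m)) tB1) as (k & Hk & Hmin).
  { induction k0 as [k IH] using lt_wf_ind.
    destruct (classic (exists m, m < k /\ eval (app p (num m)) tB0))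
      as [(m & Hm & E)|Hno]; [eauto|].
    exists k; split; [assumption|]; intros m Hm.
    destruct (Hdec m) as ([] & E & _); [|assumption].
    exfalso; eauto. }
  (* The search yields a constant function, which discards the realizer of the double negation. *)
  assert (forall q h, eval (app q (num k)) tB0 ->
    (forall m, m < k -> eval (app q (num m)) tB1) ->
    equiv (app (app srch q) h) (pair (num k) vrefl)) as Hs.
  { intros q g Hq1 Hq2.
    apply (equiv_trans _ (app (tLam tEmpty tEmpty (pair (num k) vrefl)) g)).
    - apply equiv_app, equiv_eval; [|constructor].
      apply ev_App_srch; [constructor|assumption..].
    - pose proof (equiv_app_Lam tEmpty tEmpty tEmpty tEmpty
        (pair (num k) vrefl) g) as E.
      unfold subst1 in E; simpl in E; now rewrite subst_num in E. }
  apply (el_equiv u _ (pair (num k) vrefl) (pair (num k) vrefl)).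
  - now apply Hs.
  - assert (forall m b, eval (app p (num m)) (dbool b) ->
      eval (app p' (num m)) (dbool b)) as Hp'.
    { intros m b E; destruct (Hdec m) as (c & E1 & E2).
      now rewrite (eval_det _ _ _ _ E E1). }
    apply Hs; [now apply (Hp' k true)|].
    intros m Hm; apply (Hp' m false); simpl; auto.
  - apply el_Z_intro; [eauto using el_le|assumption].
Qed.

End Model.

(** * Two worlds against [MP], one world against its negation *)

Theorem corollary6p1p2 : ~ derivable MP /\ ~ derivable (tNot MP).
Proof.
  split; intros [t Ht].
  (* [true] is the potential world, and ordering by implication puts [false] below it. *)
  - set (pot := fun w : bool => w = true).
    set (le := fun v w : bool => pot v -> pot w).
    assert (forall w, le w w) as Hrefl by (unfold le; auto).
    assert (forall u v w, le u v -> le v w -> le u w) as Htrans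
      by (unfold le; auto).
    assert (forall v w, le v w -> pot v -> pot w) as Hpot by auto.
    pose proof (fun o w => soundness_closed o bool le pot Hrefl Htrans Hpot
      _ _ w Ht) as H.
    destruct (MP_potential (fun _ => false) bool le pot Hrefl Htrans Hpot
      true t eq_refl (H _ _)) as (n & b & Hn).
    apply reads_continuous in Hn as [k Hk].
    (* The only zero lies beyond the first [k] values, on which the reading depends, and differs
       from the answer [n]. *)
    set (o := fun i => Nat.eqb i (S (k + n))).
    assert (o n = true) as Ho.
    { apply (MP_actual o bool le pot Hrefl Htrans Hpot false t (S (k + n)) n b).
      - discriminate.
      - apply H.
      - apply Nat.eqb_refl.
      - apply Hk; intros i Hi; apply Nat.eqb_neq; lia. }
    apply Nat.eqb_eq in Ho; lia.
  - set (le := fun _ _ : unit => True).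
    set (pot := fun _ : unit => False).
    assert (forall w, le w w) as Hrefl by (unfold le; auto).
    assert (forall u v w, le u v -> le v w -> le u w) as Htrans
      by (unfold le; auto).
    assert (forall v w, le v w -> pot v -> pot w) as Hpot by auto.
    set (o := fun _ : nat => false).
    pose proof (soundness_closed o unit le pot Hrefl Htrans Hpot _ _ tt Ht) as H.
    pose proof (el_MP_srch o unit le pot Hrefl Htrans Hpot tt (fun _ F => F)) as Hs.
    pose proof (el_arr_app o unit le pot Hrefl Htrans Hpot
      tt _ tEmpty _ _ _ _ H Hs) as HE.
    apply (el_Empty o unit le pot Hrefl Htrans Hpot tt tt) in HE;
      [destruct HE as [[] _]|exact I].
Qed.
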